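(* For any configuration $c\in\mathcal C$ and distinct programs $f,g\in\mathcal F$, under the simple randomized design ($\alpha$-design) with $n$ runs, conditionally on the event that every program is run at least once ($N_h>0$ for all $h\in\mathcal F$), $$\hat\Delta^c(f,g)-\delta^c(f,g)=O_p(n^{-1/2})\qquad (n\to\infty).$$
   Context: Measurement model. $\mathcal F$ is a finite set of programs, $\mathrm F=|\mathcal F|\ge 2$; $\mathcal C$ is a set of configurations. For a fixed configuration $c$, an experiment with $n$ runs generates programs $F_1,\dots,F_n\in\mathcal F$, unobserved uncontrolled states $U_1,U_2,\dots\in\mathcal U$, and real measurements $T_1,\dots,T_n$ sequentially: the initial state $U_1$ is supplied by the environment (arbitrary distribution); at run $i$ the design chooses $F_i$ (using only previously observed variables), then $T_i$ is drawn from a fixed unknown conditional distribution of $T$ given $(U=U_i,F=F_i,c)$, then $U_{i+1}$ is drawn from a fixed unknown conditional distribution given $(T=T_i,U=U_i,F=F_i,c)$. These two conditional distributions depend neither on $i$ nor on the design. Delta design. A design is a delta design if the following hold. (1) Additive global effect: $T_i=\mathcal T_i+\mathcal E_i$, where, conditionally on $F_{\le i},U_{\le i},T_{<i}$, the ''true run time'' $\mathcal T_i$ and the ''environmental noise'' $\mathcal E_i$ are independent, $\mathcal T_i$ has a fixed distribution depending only on $(F_i,c)$, and $\mathcal E_i$ has a fixed distribution depending only on $(U_i,c)$. (In the multiplicative version of the assumption, $T,\mathcal T,\mathcal E$ stand for the logarithms of the positive quantities, so the same additive formulation applies.) (2) $T$ is essentially bounded (hence so are $\mathcal T$ and $\mathcal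 E$, given $c$). (3) $F_i$ is conditionally independent of the earlier measurements and of the configuration given $F_{<i}$ (together with the sequential structure above, $F_i$ depends on the past only through $F_{<i}$), and each $F_i$ has full support $\mathcal F$. (4) The loss estimator is $\hat L(f,c)=\bar T_f=\frac1{N_f}\sum_{i=1}^n \mathbb 1_{F_i=f}T_i$, where $N_f=\sum_{i=1}^n\mathbb 1_{F_i=f}$. True loss and deltas. The true loss is $l(f,c)=\operatorname E[T\mid f,c]$, the expectation being over $T$ given $(U,f,c)$ with $U$ drawn from a fixed reference distribution $U\mid c$ that does not depend on $f$; thus $l(f,c)=\operatorname E[\mathcal T\mid f,c]+\operatorname E_{U\mid c}[\mathcal E]$. The true delta is $\delta^c(f,g)=l(f,c)-l(g,c)$ and the estimated delta is $\hat\Delta^c(f,g)=\hat L(f,c)-\hat L(g,c)$. Simple randomized design ($\alpha$-design). The delta design in which, for every run $i\in[1,n]$, $F_i$ is chosen uniformly and independently from $\mathcal F$. The run counts are required to satisfy $N_h>0$ for all $h\in\mathcal F$ so that averages are defined; this is the conditioning in the claim. $X_n=O_p(a_n)$ means that $X_n/a_n$ is bounded in probability. *)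

(* Defs.v *)
(* Runs are numbered from 0: the informal run i is run i-1. *)
From HB Require Import structures.
From mathcomp Require Import all_boot all_order all_algebra.
From mathcomp Require Import all_classical all_reals all_analysis.

Set Implicit Arguments.
Unset Strict Implicit.
Unset Printing Implicit Defensive.
Import Order.TTheory GRing.Theory Num.Theory.

Local Open Scope classical_set_scope.
Local Open Scope ring_scope.

(* [A] has conditional probability [k] given the sigma-algebra [G]. The
   [G]-measurability of [k] is not part of the definition: below, [k] is always
   a measurable function of variables that generate [G]. *)
Definition cond_prob_given d (Om : measurableType d) (R : realType)
    (P : probability Om R) (G : set (set Om)) (A : set Om) (k : Om -> \bar R) :=
  forall H, G H -> P (H `&` A) = (\int[P]_(w in H) k w)%E.

(* Conditional probability of [A] given an event [B]; the value is 0 if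
   [P B = 0]. *)
Definition cond_prob d (Om : measurableType d) (R : realType)
    (P : probability Om R) (A B : set Om) : R :=
  fine (P (A `&` B)) / fine (P B).

(* X_n = O_p(a_n), where X_n lives on its own probability space and its law is
   the one conditional on the event B_n. The bound is required for all large n
   only, so the finitely many n with [P (B n) = 0] are irrelevant when [P (B n)]
   is eventually positive. *)
Definition bigO_p_given (R : realType) (d : nat -> measure_display)
    (Om : forall n, measurableType (d n)) (P : forall n, probability (Om n) R)
    (B : forall n, set (Om n)) (X : forall n, Om n -> R) (a : nat -> R) :=
  forall eps : R, 0 < eps ->
    exists K : R, exists N : nat, forall n, (N <= n)%N ->
      cond_prob (P n) [set w | K < `|X n w / a n|] (B n) <= eps.

Section measurement_model.
Context (R : realType) (dU : measure_display) (U : measurableType dU)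
  (F : finType) (C : Type).

(* [meas_law c f u] is the law of T given (U = u, F = f, c); [state_law c f
   (t, u)] is the law of the next state given (T = t, U = u, F = f, c);
   [ref_state c] is the reference distribution U | c of the true loss. As [F] is
   finite, measurability in the state and the measurement is all that is asked
   of the conditional laws. *)
Record environment := Environment {
  meas_law : C -> F -> R.-pker U ~> measurableTypeR R ;
  state_law : C -> F -> R.-pker (measurableTypeR R * U)%type ~> U ;
  ref_state : C -> probability U R }.

(* [policy c fs ts f] is the probability that run i chooses f, given the
   configuration c and the programs fs and measurements ts of the i earlier
   runs. *)
Record design := Design {
  policy : C -> forall i, i.-tuple F -> i.-tuple (measurableTypeR R) -> F -> R ;
  policy_ge0 : forall c i (fs : i.-tuple F) ts f, 0 <= policy c fs ts f ;
  policy_sum1 : forall c i (fs : i.-tuple F) ts,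
    \sum_(f : F) policy c fs ts f = 1 ;
  policy_measurable : forall c i (fs : i.-tuple F) f,
    measurable_fun [set: i.-tuple (measurableTypeR R)]
      (fun ts => policy c fs ts f : measurableTypeR R) }.

(* Only runs i < n, and states i <= n, of the sequences below are constrained in
   an experiment with n runs. *)
Record experiment := Experiment {
  sample_disp : measure_display ;
  sample : measurableType sample_disp ;
  Pr : probability sample R ;
  prog : nat -> sample -> F ;
  prog_measurable : forall i f, measurable (prog i @^-1` [set f]) ;
  state : nat -> {RV Pr >-> U} ;
  meas : nat -> {RV Pr >-> measurableTypeR R} }.

Section experiment.
Variable e : experiment.

(* The sigma-algebra of the first [a] programs, [b] states, [k] measurements. *)
Definition history (a b k : nat) : set (set (sample e)) :=
  <<s (\bigcup_(j in `I_a) preimage_set_system setT (@prog e j) setT) `|`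
      (\bigcup_(j in `I_b) preimage_set_system setT (@state e j) measurable) `|`
      (\bigcup_(j in `I_k) preimage_set_system setT (@meas e j) measurable) >>.

Definition past_progs i (w : sample e) : i.-tuple F :=
  [tuple prog j w | j < i].

Definition past_meas i (w : sample e) : i.-tuple (measurableTypeR R) :=
  [tuple (meas e j w : measurableTypeR R) | j < i].

Definition measurement_model (env : environment) (D : design) (c : C)
    (n : nat) :=
  forall i, (i < n)%N ->
  [/\ forall f : F,
        cond_prob_given (Pr e) (history i i.+1 i) (prog i @^-1` [set f])
          (fun w => (policy D c (past_progs i w) (past_meas i w) f)%:E),
      forall B : set (measurableTypeR R), measurable B ->
        cond_prob_given (Pr e) (history i.+1 i.+1 i) (meas e i @^-1` B)
          (fun w => meas_law env c (prog i w) (state e i w) B)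
    & forall B : set U, measurable B ->
        cond_prob_given (Pr e) (history i.+1 i.+1 i.+1)
          (state e i.+1 @^-1` B)
          (fun w => state_law env c (prog i w) (meas e i w, state e i w) B)].

(* N_f *)
Definition run_count (n : nat) (f : F) (w : sample e) : nat :=
  (\sum_(i < n) (prog i w == f))%N.

(* L^(f, c), the loss estimator of a delta design *)
Definition loss_estimator (n : nat) (f : F) (w : sample e) : R :=
  ((run_count n f w)%:R)^-1 * \sum_(i < n) (prog i w == f)%:R * meas e i w.

Definition estimated_delta (n : nat) (f g : F) (w : sample e) : R :=
  loss_estimator n f w - loss_estimator n g w.

Definition all_programs_run (n : nat) : set (sample e) :=
  [set w | forall h : F, (0 < run_count n h w)%N].

End experiment.

(* l(f, c) = E[T | f, c], where U is drawn from U | c *)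
Definition true_loss (env : environment) (f : F) (c : C) : R :=
  fine (\int[ref_state env c]_u \int[meas_law env c f u]_t (t : R)%:E)%E.

Definition true_delta (env : environment) (c : C) (f g : F) : R :=
  true_loss env f c - true_loss env g c.

(* The laws of the true run time given (f, c) and of the noise given (u, c). *)
Record additive_laws := AdditiveLaws {
  true_law : C -> F -> probability (measurableTypeR R) R ;
  noise_law : C -> R.-pker U ~> measurableTypeR R }.

(* The additive global effect, both for the fixed conditional law of T (which
   also enters the true loss) and for the variables of the experiment. *)
Definition additive_effect (env : environment) (L : additive_laws) (c : C)
    (n : nat) (e : experiment) :=
  (forall f u (B : set (measurableTypeR R)), measurable B ->
     meas_law env c f u B =
     (true_law L c f \x noise_law L c u)%E
       [set x : measurableTypeR R * measurableTypeR R | B (x.1 + x.2)]) /\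
  exists tau eta : nat -> {RV Pr e >-> measurableTypeR R},
    forall i, (i < n)%N ->
      (forall w, meas e i w = tau i w + eta i w) /\
      forall A B : set (measurableTypeR R), measurable A -> measurable B ->
        cond_prob_given (Pr e) (@history e i.+1 i.+1 i)
          ((tau i @^-1` A) `&` (eta i @^-1` B))
          (fun w => true_law L c (prog i w) A *
                    noise_law L c (state e i w) B)%E.

(* T is bounded by [M] almost surely, both when the state has the reference
   distribution and when it is produced by the experiment; these state
   distributions need not be related. *)
Definition essentially_bounded (env : environment) (M : R) (c : C)
    (n : nat) (e : experiment) :=
  {ae ref_state env c, forall u, forall f,
     meas_law env c f u [set t : measurableTypeR R | `|(t : R)| <= M] = 1%E} /\
  forall i, (i < n)%N -> {ae Pr e, forall w, `|(meas e i w : R)| <= M}.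

(* The choice of a program depends on the past only through earlier programs,
   and not on the configuration. *)
Definition oblivious (D : design) :=
  forall c c' i (fs : i.-tuple F) ts ts' f,
    policy D c fs ts f = policy D c' fs ts' f.

Definition full_support (n : nat) (e : experiment) :=
  forall i, (i < n)%N -> forall f : F, (0 < Pr e (prog i @^-1` [set f]))%E.

Record delta_design (env : environment) (L : additive_laws) (M : R)
    (D : design) (c : C) (n : nat) (e : experiment) : Prop := DeltaDesign {
  delta_model : measurement_model e env D c n ;
  delta_additive : additive_effect env L c n e ;
  delta_bounded : essentially_bounded env M c n e ;
  delta_oblivious : oblivious D ;
  delta_support : full_support n e }.

(* The alpha-design: given the past, every program has probability 1 / #|F|. *)
Definition simple_randomized_design (env : environment) (L : additive_laws)
    (M : R) (D : design) (c : C) (n : nat) (e : experiment) :=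
  delta_design env L M D c n e /\
  forall i (fs : i.-tuple F) ts f, policy D c fs ts f = (#|F|%:R)^-1.

End measurement_model.

(* Main.v *)
(* Write p = 1 / #|F| and m_h(u) for the mean of T given the program h and the
   state u. As the law of T is the convolution of a law depending on h and a law
   depending on u, m_h(u) = mu_h + nu(u) on all states that make T bounded, and
   the true delta of f and g is mu_f - mu_g. Let X_i = T_i - mu_(F_i) and
   S = \sum_i X_i. Since F_i is uniform given the past and the current state,
   the terms ([F_i = f] - p) X_i are orthogonal: conditioning first on the past
   including F_i replaces X_i by nu(U_i), and [F_i = f] - p then has mean zero
   given U_i. The same holds for [F_i = f] - p alone. Hence
   D_f = \sum_i ([F_i = f] - p) X_i and N_f - p n have second moments O(n).
   Finally L^(f) - mu_f = (D_f + p S) / N_f, which differs from S / n by at most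
   (|D_f| + K |N_f - p n|) / N_f, and the term S / n cancels between f and g.
   The event that all programs are run has probability tending to 1, so
   conditioning on it costs a bounded factor. *)
Require Import Defs.
From HB Require Import structures.
From mathcomp Require Import all_boot all_order all_algebra.
From mathcomp Require Import all_classical all_reals all_analysis.
From mathcomp Require Import measurable_realfun ring lra.

Set Implicit Arguments.
Unset Strict Implicit.
Unset Printing Implicit Defensive.
Import Order.TTheory GRing.Theory Num.Theory.

Local Open Scope classical_set_scope.
Local Open Scope ring_scope.

(** * Bounded measurable functions and their integrals *)

(** The bound holds everywhere and not almost everywhere, so that one function is integrable under
    all probabilities at once, in particular under every law [k u] of a kernel. *)
Definition bounded_mfun d (T : measurableType d) (R : realType) (X : T -> R) :=
  measurable_fun setT X /\ exists K, forall w, `|X w| <= K.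

Section bounded_mfun_theory.
Context d (T : measurableType d) (R : realType).
Implicit Types X Y : T -> R.

Lemma bmf_cst (a : R) : bounded_mfun (fun _ : T => a).
Proof. by split; [exact: measurable_cst | exists `|a|]. Qed.

Lemma bmfD X Y : bounded_mfun X -> bounded_mfun Y ->
  bounded_mfun (fun w => X w + Y w).
Proof.
move=> [mX [K bX]] [mY [L bY]]; split; first exact: measurable_funD.
by exists (K + L) => w; rewrite (le_trans (ler_normD _ _)) ?lerD.
Qed.

Lemma bmfM X Y : bounded_mfun X -> bounded_mfun Y ->
  bounded_mfun (fun w => X w * Y w).
Proof.
move=> [mX [K bX]] [mY [L bY]]; split; first exact: measurable_funM.
by exists (K * L) => w; rewrite normrM ler_pM.
Qed.

Lemma bmfN X : bounded_mfun X -> bounded_mfun (fun w => - X w).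
Proof.
move=> bX; rewrite (_ : (fun w => - X w) = fun w => -1 * X w).
  by apply: bmfM => //; exact: bmf_cst.
by apply/funext => w; rewrite mulN1r.
Qed.

Lemma bmfB X Y : bounded_mfun X -> bounded_mfun Y ->
  bounded_mfun (fun w => X w - Y w).
Proof. by move=> bX bY; apply: bmfD => //; exact: bmfN. Qed.

Lemma bmf_sum (I : Type) (r : seq I) (Q : pred I) (X : I -> T -> R) :
  (forall i, bounded_mfun (X i)) ->
    bounded_mfun (fun w => \sum_(i <- r | Q i) X i w).
Proof.
move=> bX; elim: r => [|i r IHr].
  by under eq_fun do rewrite big_nil; exact: bmf_cst.
under eq_fun do rewrite big_cons; case: (Q i) => //; exact: bmfD.
Qed.

Lemma bmf_indic (A : set T) : measurable A -> bounded_mfun (\1_A : T -> R).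
Proof.
move=> mA; split; first exact: measurable_indic.
by exists 1 => w; rewrite indicE; case: (_ \in _); rewrite ?normr1 ?normr0.
Qed.

Lemma bmf_comp d' (T' : measurableType d') (h : T' -> T) X :
  measurable_fun setT h -> bounded_mfun X -> bounded_mfun (X \o h).
Proof.
move=> mh [mX [K bX]]; split; first exact: measurableT_comp.
by exists K => w; exact: bX.
Qed.

Variables (P : {measure set T -> \bar R}) (P1 : P setT = 1%E).

Lemma bmf_integrable X : bounded_mfun X -> P.-integrable setT (EFin \o X).
Proof.
move=> [mX [K bX]]; apply: measurable_bounded_integrable => //.
  by rewrite P1 ltry.
exists K; split; first exact: num_real.
by move=> L KL w _; exact: le_trans (bX w) (ltW KL).
Qed.

Lemma integral_bmf X : bounded_mfun X ->
  (\int[P]_w (X w)%:E)%E = (\int[P]_w X w)%:E.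
Proof.
by move=> bX; rewrite /Rintegral fineK//; apply: integrable_fin_num => //;
  exact: bmf_integrable.
Qed.

Lemma Rintegral_prob_cst (a : R) : \int[P]_w a = a.
Proof. by rewrite Rintegral_cst// P1 mulr1. Qed.

Lemma RintegralD_bmf X Y : bounded_mfun X -> bounded_mfun Y ->
  \int[P]_w (X w + Y w) = \int[P]_w X w + \int[P]_w Y w.
Proof. by move=> bX bY; rewrite RintegralD//; exact: bmf_integrable. Qed.

Lemma RintegralZl_bmf (a : R) X : bounded_mfun X ->
  \int[P]_w (a * X w) = a * \int[P]_w X w.
Proof. by move=> bX; rewrite RintegralZl//; exact: bmf_integrable. Qed.

Lemma RintegralB_bmf X Y : bounded_mfun X -> bounded_mfun Y ->
  \int[P]_w (X w - Y w) = \int[P]_w X w - \int[P]_w Y w.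
Proof. by move=> bX bY; rewrite RintegralB//; exact: bmf_integrable. Qed.

Lemma Rintegral_sum_bmf (I : Type) (r : seq I) (Q : pred I) (X : I -> T -> R) :
  (forall i, bounded_mfun (X i)) ->
  \int[P]_w (\sum_(i <- r | Q i) X i w) = \sum_(i <- r | Q i) \int[P]_w X i w.
Proof.
move=> bX; elim: r => [|i r IHr].
  by under eq_Rintegral do rewrite big_nil; rewrite Rintegral_prob_cst big_nil.
under eq_Rintegral do rewrite big_cons; rewrite big_cons.
by case: (Q i) => //; rewrite RintegralD_bmf ?IHr//; exact: bmf_sum.
Qed.

Lemma le_Rintegral_bmf X Y : bounded_mfun X -> bounded_mfun Y ->
  (forall w, X w <= Y w) ->
  \int[P]_w X w <= \int[P]_w Y w.
Proof.
by move=> bX bY XY; apply: le_Rintegral => //; exact: bmf_integrable.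
Qed.

Lemma normr_Rintegral_bmf_le X (K : R) : bounded_mfun X ->
  (forall w, `|X w| <= K) ->
  `|\int[P]_w X w| <= K.
Proof.
move=> bX XK;
  rewrite ler_norml -{1}(Rintegral_prob_cst (- K)) -{2}(Rintegral_prob_cst K).
by apply/andP; split; apply: le_Rintegral_bmf => //; try exact: bmf_cst;
  move=> w; have := XK w; rewrite ler_norml => /andP[].
Qed.

Lemma Rintegral_indic (A : set T) : measurable A ->
  \int[P]_w (\1_A w) = fine (P A).
Proof. by move=> mA; rewrite /Rintegral integral_indic// setIT. Qed.

End bounded_mfun_theory.

#[local] Hint Extern 0 (_ setT = 1%E) =>
  solve [exact: probability_setT | exact: prob_kernel] : core.

(** * From indicators to bounded functions *)

(** The sum counts the thresholds 1, ..., m that are at most y. It is the integer part of y until it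
    saturates at m, which is the second alternative. *)
Lemma staircase_approx (R : realType) (y : R) m : 0 <= y ->
  \sum_(i < m) (i.+1%:R <= y)%R%:R <= y /\
  (y <= \sum_(i < m) (i.+1%:R <= y)%R%:R + 1 \/ m%:R <= y /\
   \sum_(i < m) (i.+1%:R <= y)%R%:R = m%:R :> R).
Proof.
move=> y0; have cm k : \sum_(i < k) (i.+1%:R <= y)%R%:R <= k%:R :> R.
  rewrite -[leRHS](_ : \sum_(i < k) 1 = _); last first.
    by rewrite sumr_const card_ord.
  by apply: ler_sum => i _; case: (_ <= y).
elim: m => [|m [IH1 IH2]]; first by rewrite big_ord0; split => //; right.
rewrite big_ord_recr /=; have cmm := cm m.
case: (lerP m.+1%:R y) => my; rewrite /= ?mulr1n ?mulr0n ?addr0;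
  rewrite -natr1 in my *.
- split; first by lra.
  by case: IH2 => [|[? ->]]; [left; lra | right].
- by split; [lra | left; case: IH2 => [|[? ?]]; lra].
Qed.

(* Bounded measurable functions are uniform limits of linear combinations of
   indicators. *)
Lemma bmf_functional_eq0 d (T : measurableType d) (R : realType)
    (Lam : (T -> R) -> R) (C : R) :
  (forall X Y, bounded_mfun X -> bounded_mfun Y ->
    Lam (fun w => X w + Y w) = Lam X + Lam Y) ->
  (forall a X, bounded_mfun X -> Lam (fun w => a * X w) = a * Lam X) ->
  (forall X K, bounded_mfun X -> (forall w, `|X w| <= K) ->
    `|Lam X| <= C * K) ->
  (forall A, measurable A -> Lam (\1_A) = 0) ->
  forall X, bounded_mfun X -> Lam X = 0.
Proof.
move=> LD LZ Lb L1 X [mX [K0 bX0]].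
pose K := `|K0| + 1; have K_gt0 : 0 < K by rewrite /K ltr_wpDl.
have bX w : `|X w| <= K.
  by rewrite (le_trans (bX0 w))// /K (le_trans (ler_norm _))// lerDl.
have mS (a : R) : measurable [set w | a <= X w].
  rewrite (_ : [set w | _] = setT `&` X @^-1` `[a, +oo[%classic).
    by apply: mX => //; exact: measurable_itv.
  by apply/seteqP; split => w; rewrite setTI /= in_itv/= andbT.
have L1' : Lam (fun=> 1) = 0.
  by rewrite -(L1 setT)//; congr Lam; apply/funext => w; rewrite indicT.
(* [V] is a staircase below [X] with m + 1 steps of height q covering the range [-K, K]. [Lam]
   vanishes on it and [X - V] lies in [0, q], so the bound on [Lam] gives C q. *)
have key m : `|Lam X| <= C * (2 * K / m.+1%:R).
  pose q := 2 * K / m.+1%:R.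
  have q0 : 0 < q by rewrite divr_gt0 // mulr_gt0.
  pose st (i : 'I_m.+1) : T -> R := \1_[set w | i.+1%:R * q - K <= X w].
  have bst i : bounded_mfun (st i) by exact: bmf_indic.
  pose Z w := \sum_(i < m.+1) st i w.
  have bZ : bounded_mfun Z by exact: bmf_sum.
  have LZ0 : Lam Z = 0.
    rewrite /Z; elim: (index_enum _) => [|i r IHr].
      under eq_fun do rewrite big_nil.
      by have := LZ 0 _ (bmf_cst T (0 : R)); rewrite !mul0r.
    under eq_fun do rewrite big_cons.
    by rewrite LD ?IHr ?L1 ?addr0//; exact: bmf_sum.
  pose V w := q * Z w - K * 1.
  have bV : bounded_mfun V.
    by apply: bmfB; apply: bmfM => //; exact: bmf_cst.
  have LV : Lam V = 0.
    rewrite /V (_ : (fun w => _) = fun w => q * Z w + (- K) * 1); last first.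
      by apply/funext => w; rewrite mulNr.
    rewrite LD; [|by apply: bmfM => //; exact: bmf_cst|
      by apply: bmfM; exact: bmf_cst].
    by rewrite !LZ ?L1' ?LZ0 ?mulr0 ?addr0//; exact: bmf_cst.
  have bXV : bounded_mfun (fun w => X w + -1 * V w).
    apply: bmfD; first by split => //; exists K.
    by apply: bmfM => //; exact: bmf_cst.
  have -> : Lam X = Lam (fun w => X w + -1 * V w).
    rewrite LD ?LZ ?LV ?mulr0 ?addr0//; first by split => //; exists K.
    by apply: bmfM => //; exact: bmf_cst.
  apply: Lb => // w; rewrite -/q /V.
  pose y := (X w + K) / q.
  have yq : y * q = X w + K by rewrite /y divfK// gt_eqF.
  have /andP[X1 X2] : - K <= X w <= K by rewrite -ler_norml.
  have y0 : 0 <= y by rewrite /y divr_ge0 ?(ltW q0)// -lerBlDr sub0r.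
  have ym : y <= m.+1%:R.
    rewrite /y ler_pdivrMr// /q mulrC divfK ?pnatr_eq0//; lra.
  have -> : Z w = \sum_(i < m.+1) (i.+1%:R <= y)%R%:R.
    apply: eq_bigr => i _; rewrite /st indicE /y ler_pdivlMr// -lerBlDr.
    by congr (nat_of_bool _)%:R; apply/idP/idP => [|?];
      [rewrite inE | rewrite inE].
  have [c1 c2] := staircase_approx m.+1 y0.
  set c := \sum_(i < _) _ in c1 c2 *.
  have -> : X w + -1 * (q * c - K * 1) = (y - c) * q.
    by rewrite mulrBl yq; ring.
  rewrite normrM (gtr0_norm q0) ler_piMl ?(ltW q0)// ger0_norm ?subr_ge0//.
  by case: c2 => [|[? ->]]; lra.
(* The bound of [key] tends to 0 with the step height, so a nonzero value contradicts the
   Archimedean property. *)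
apply/eqP; rewrite -normr_le0 leNgt; apply/negP => L0.
have [n Hn] : exists n, C * (2 * K) / `|Lam X| < n%:R.
  by exists (Num.bound `|C * (2 * K) / `|Lam X| |);
    rewrite (le_lt_trans (ler_norm _))// archi_boundP.
have := key n; rewrite mulrA ler_pdivlMr// leNgt => /negP; apply.
rewrite ltr_pdivrMr// in Hn; rewrite (lt_le_trans Hn)// mulrC ler_pM2l//.
by rewrite ler_nat.
Qed.

(** * Conditioning on a sub-sigma-algebra and on a kernel *)

Lemma measurable_sub_sigma d (T : measurableType d) (GG : set (set T)) :
  <<s GG >> `<=` @measurable _ T ->
  forall d' (T' : measurableType d') (X : T -> T'),
  @measurable_fun _ _ (g_sigma_algebraType GG) T' setT X ->
    measurable_fun setT X.
Proof. by move=> sub d' T' X mX _ B mB; apply: sub; exact: mX. Qed.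

Lemma bmf_sub_sigma d (T : measurableType d) (R : realType)
    (GG : set (set T)) (X : T -> R) :
  <<s GG >> `<=` @measurable _ T ->
  @bounded_mfun _ (g_sigma_algebraType GG) R X -> bounded_mfun X.
Proof.
by move=> sub [mX bX]; split => //; exact: measurable_sub_sigma sub _ _ _ mX.
Qed.

(** The functional taking W to E[W Z] is linear, bounded by sup |Z|, and zero on indicators of the
    sub-sigma-algebra; [bmf_functional_eq0], applied on the coarser measurable type, extends this to
    bounded W. *)
Lemma integral_sub_sigma_eq0 d (T : measurableType d) (R : realType)
    (P : {measure set T -> \bar R}) (P1 : P setT = 1%E) (GG : set (set T))
    (Z W : T -> R) :
  <<s GG >> `<=` @measurable _ T -> bounded_mfun Z ->
  (forall H, <<s GG >> H -> \int[P]_w (\1_H w * Z w) = 0) ->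
  @bounded_mfun _ (g_sigma_algebraType GG) R W -> \int[P]_w (W w * Z w) = 0.
Proof.
move=> sub bZ Z0 bW; have sbmf := bmf_sub_sigma sub.
have [_ [C ZC]] := bZ.
apply: (@bmf_functional_eq0 _ (g_sigma_algebraType GG) R
  (fun W => \int[P]_w (W w * Z w)) C) => //.
- move=> X Y /sbmf bX /sbmf bY.
  by rewrite -RintegralD_bmf//;
    [under eq_Rintegral do rewrite mulrDl|exact: bmfM..].
- move=> a X /sbmf bX.
  by rewrite -RintegralZl_bmf//;
    [under eq_Rintegral do rewrite -mulrA|exact: bmfM].
- move=> X K /sbmf bX XK; apply: normr_Rintegral_bmf_le => //;
  first exact: bmfM.
  by move=> w; rewrite normrM mulrC ler_pM.
Qed.

Lemma bmf_kernel d d' (U : measurableType d) (V : measurableType d')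
    (R : realType) (k : R.-pker U ~> V) (phi : V -> R) :
  bounded_mfun phi -> bounded_mfun (fun u => \int[k u]_v phi v).
Proof.
move=> bphi; have [mphi [K phiK]] := bphi; split; last first.
  by exists K => u; exact: normr_Rintegral_bmf_le.
(* Adding K makes the integrand nonnegative, as measurability of kernel integrals asks; the shift is
   undone since each [k u] has mass one. *)
have bK : bounded_mfun (fun v => phi v + K) by apply: bmfD => //;
  exact: bmf_cst.
rewrite (_ : (fun u => _) =
    fun u => fine (\int[k u]_v (phi v + K)%:E)%E - K); last first.
  apply/funext => u; rewrite -/(Rintegral (k u) setT (fun v => phi v + K)).
  by rewrite RintegralD_bmf ?Rintegral_prob_cst ?addrK//; exact: bmf_cst.
apply: measurable_funB => //; apply: measurableT_comp => //.
apply: measurable_fun_integral_kernel => //.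
- by move=> B mB; exact: measurable_kernel.
- move=> v; rewrite lee_fin -lerBlDr sub0r.
  by have := phiK v; rewrite ler_norml => /andP[].
- by apply/measurable_EFinP; exact: bK.1.
Qed.

(** The hypothesis is the case of an indicator [phi]. The integral is linear in [phi] and at most 2
    sup |phi|, one sup for each of the two terms, so [bmf_functional_eq0] gives the general case. *)
Lemma integral_kernel_law d d' d'' (T : measurableType d)
    (U : measurableType d') (V : measurableType d'') (R : realType)
    (P : {measure set T -> \bar R}) (P1 : P setT = 1%E)
    (k : R.-pker U ~> V) (A : set T) (X : T -> U) (Y : T -> V) (phi : V -> R) :
  measurable A -> measurable_fun setT X -> measurable_fun setT Y ->
  (forall B, measurable B ->
     P (A `&` Y @^-1` B) = (\int[P]_(w in A) k (X w) B)%E) ->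
  bounded_mfun phi ->
  \int[P]_w (\1_A w * (phi (Y w) - \int[k (X w)]_v phi v)) = 0.
Proof.
move=> mA mX mY kB bphi.
have bA : bounded_mfun (\1_A : T -> R) by exact: bmf_indic.
have bXk psi : bounded_mfun psi ->
  bounded_mfun (fun w => \int[k (X w)]_v psi v).
  by move=> bpsi; exact: (bmf_comp mX (bmf_kernel k bpsi)).
have bI psi : bounded_mfun psi ->
  bounded_mfun (fun w => psi (Y w) - \int[k (X w)]_v psi v).
  by move=> bpsi; apply: bmfB; [exact: (bmf_comp mY bpsi)|exact: bXk].
apply: (@bmf_functional_eq0 _ V R
  (fun phi => \int[P]_w (\1_A w * (phi (Y w) - \int[k (X w)]_v phi v)))
    2) => //.
- move=> f g bf bg; rewrite -RintegralD_bmf//;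
  [|by apply: bmfM => //; exact: bI..].
  by apply: eq_Rintegral => w _; rewrite RintegralD_bmf//; ring.
- move=> a f bf; rewrite -RintegralZl_bmf//;
  [|by apply: bmfM => //; exact: bI..].
  by apply: eq_Rintegral => w _; rewrite RintegralZl_bmf//; ring.
- move=> f K bf fK; apply: normr_Rintegral_bmf_le => //; first by apply: bmfM =>
  //; exact: bI.
  move=> w; rewrite normrM indicE
    (@le_trans _ _ (1 * `|f (Y w) - \int[k (X w)]_v f v|))//.
    by apply: ler_wpM2r => //; case: (_ \in _); rewrite ?normr1 ?normr0.
  rewrite mul1r mulrDl mul1r (le_trans (ler_normB _ _))// lerD//.
  exact: normr_Rintegral_bmf_le.
- move=> B mB; have bB : bounded_mfun (\1_B : V -> R) by exact: bmf_indic.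
  under eq_Rintegral do rewrite mulrBr.
  rewrite RintegralB_bmf//; [|by apply: bmfM => //; exact: (bmf_comp mY bB)|
    by apply: bmfM => //; exact: bXk].
  apply/eqP; rewrite subr_eq0; apply/eqP.
  transitivity (fine (P (A `&` Y @^-1` B))).
    rewrite -Rintegral_indic//; last first.
      by apply: measurableI => //; rewrite -[X in measurable X]setTI; exact: mY.
    by apply: eq_Rintegral => w _; rewrite indicI.
  rewrite kB// integral_mkcond; congr fine; apply: eq_integral => w _.
  rewrite patchE indicE; case: ifPn => wA; rewrite ?mul0r//= mul1r.
  rewrite -integral_bmf//; rewrite integral_indic// setIT//.
Qed.

(** * Almost everywhere properties *)

Lemma ae_exists d (T : measurableType d) (R : realType)
    (P : {measure set T -> \bar R}) (P1 : P setT = 1%E) (Q : T -> Prop) :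
  {ae P, forall w, Q w} -> exists w, Q w.
Proof.
have P0 : (0 < P setT)%E by rewrite P1 lte01.
by move/(@filter_ex _ _ (ae_properfilter_algebraOfSetsType P0)).
Qed.

Lemma bmf_ge0_ae_eq0 d (T : measurableType d) (R : realType)
    (P : {measure set T -> \bar R}) (P1 : P setT = 1%E) (X : T -> R) :
  bounded_mfun X -> (forall w, 0 <= X w) -> \int[P]_w X w = 0 ->
  {ae P, forall w, X w = 0}.
Proof.
move=> bX X0 EX.
have [mX _] := bX.
have /ae_eq_integral_abs : (\int[P]_w `|(X w)%:E| = 0)%E.
  rewrite -[RHS](congr1 EFin EX) -integral_bmf//.
  by apply: eq_integral => w _; rewrite abse_EFin ger0_norm.
move=> /(_ measurableT) []; first exact/measurable_EFinP.
move=> N [mN PN XN]; exists N; split => // w /= Xw; apply: XN => /= Xw0.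
by apply: Xw; have [] := Xw0 I.
Qed.

Lemma bmf_ae_eq d (T : measurableType d) (R : realType)
    (P : {measure set T -> \bar R}) (X Y : T -> R) :
  bounded_mfun X -> bounded_mfun Y -> {ae P, forall w, X w = Y w} ->
  \int[P]_w X w = \int[P]_w Y w.
Proof.
move=> [mX _] [mY _] XY; congr fine; apply: ae_eq_integral => //.
- exact/measurable_EFinP.
- exact/measurable_EFinP.
by apply: filterS XY => w ->.
Qed.

(** * Integration against a convolution *)

Section convolution.
Context (R : realType).
Local Notation mR := (measurableTypeR R).

Definition is_convolution (alpha beta : probability mR R)
  (k : set mR -> \bar R) :=
  forall B : set mR, measurable B ->
    k B = (alpha \x beta)%E [set x : mR * mR | B (x.1 + x.2)].

Lemma measurable_sum2 :
  measurable_fun setT (fun x : mR * mR => (x.1 + x.2 : mR)).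
Proof.
by apply: measurable_funD; [exact: measurable_fst|exact: measurable_snd].
Qed.

Lemma measurable_addr (y : R) :
  measurable_fun setT (fun x : mR => (x + y : mR)).
Proof. by apply: measurable_funD => //; exact: measurable_cst. Qed.

Lemma bmf_fubini d1 d2 (T1 : measurableType d1) (T2 : measurableType d2)
    (m1 : probability T1 R) (psi : T1 * T2 -> R) :
  bounded_mfun psi -> bounded_mfun (fun y => \int[m1]_x psi (x, y)).
Proof.
move=> [mpsi [K psiK]].
have bpsi y : bounded_mfun (fun x => psi (x, y)).
  split; last by exists K => x; exact: psiK.
  by apply: measurableT_comp => //; exact: measurable_pair2.
split; last by exists K => y; exact: normr_Rintegral_bmf_le.
rewrite (_ : (fun y => _) =
    fun y => fine (fubini_G m1 (fun x => (psi x + K)%:E) y) - K); last first.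
  apply/funext => y.
  rewrite /fubini_G -/(Rintegral m1 setT (fun x => psi (x, y) + K)).
  by rewrite RintegralD_bmf ?Rintegral_prob_cst ?addrK//; exact: bmf_cst.
apply: measurable_funB => //; apply: measurableT_comp => //.
apply: measurable_fun_fubini_tonelli_G.
- by apply/measurable_EFinP; exact: measurable_funD.
- move=> v; rewrite lee_fin -lerBlDr sub0r.
  by have := psiK v; rewrite ler_norml => /andP[].
Qed.

Variables (alpha beta : probability mR R) (k : {measure set mR -> \bar R}).
Hypothesis k1 : k setT = 1%E.
Hypothesis kE : is_convolution alpha beta k.

Lemma bmf_conv (phi : mR -> R) : bounded_mfun phi ->
  bounded_mfun (fun y => \int[alpha]_x phi (x + y)).
Proof.
move=> bphi; apply: (bmf_fubini alpha (psi := fun x => phi (x.1 + x.2))).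
exact: (bmf_comp measurable_sum2 bphi).
Qed.

(** [k] is the image of the product measure under addition: change variables, then apply Fubini. *)
Lemma Rintegral_convolution (phi : mR -> R) : bounded_mfun phi ->
  \int[k]_t phi t = \int[beta]_y \int[alpha]_x phi (x + y).
Proof.
move=> bphi.
pose ab := (alpha \x beta)%E.
have ab1 : ab setT = 1%E by rewrite -k1 kE.
have bs := bmf_comp measurable_sum2 bphi.
have iab := bmf_integrable ab1 bs.
rewrite /Rintegral; congr fine.
have mphi : measurable_fun setT (EFin \o phi) by apply/measurable_EFinP;
  exact: bphi.1.
have E := @integral_pushforward _ _ _ _ _ _ measurable_sum2 _ setT _ mphi iab
  measurableT.
have -> : (\int[k]_t (phi t)%:E = \int[ab]_x (phi (x.1 + x.2)%R)%:E)%E.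
  by apply: eq_trans E; apply: eq_measure_integral;
    [exact: measurable_sum2|move=> mS A mA _; exact: kE].
rewrite -integral21_prod_meas1//.
apply: eq_integral => y _; rewrite /fubini_G /= integral_bmf//.
exact: (bmf_comp (measurable_addr y) bphi).
Qed.

End convolution.

(** * Truncation of measurements at the bound [M] *)

Section truncation.
Context (R : realType) (M : R).
Local Notation mR := (measurableTypeR R).

Definition beyond : set mR := [set t | M < `|t : R|].

(** A bounded stand-in for the identity, equal to it off [beyond], which is null for the laws
    considered. *)
Definition trunc (t : mR) : R := if M < `|t : R| then 0 else t.

Lemma measurable_beyond : measurable beyond.
Proof.
rewrite (_ : beyond = setT `&` (@Num.norm R R) @^-1` `]M, +oo[%classic).
  by apply: normr_measurable => //; exact: measurable_itv.
by apply/seteqP; split => t; rewrite setTI /= in_itv/= andbT.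
Qed.

Lemma bmf_beyond : bounded_mfun (\1_beyond : mR -> R).
Proof. by apply: bmf_indic; exact: measurable_beyond. Qed.

(** The bound is [|M|] because no sign of [M] is assumed; for negative [M] the truncation is
    identically 0. *)
Lemma trunc_le (t : mR) : `|trunc t| <= `|M|.
Proof.
rewrite /trunc; case: ltP => [_|tM]; first by rewrite normr0.
by rewrite (le_trans tM)// ler_norm.
Qed.

Lemma bmf_trunc : bounded_mfun trunc.
Proof.
split; last by exists `|M| => t; exact: trunc_le.
rewrite (_ : trunc = fun t : mR => (t : R) * (1 - \1_beyond t)).
  apply: measurable_funM => //; apply: measurable_funB => //.
  exact: bmf_beyond.1.
apply/funext => t; rewrite /trunc indicE.
case: ltP => tM; [rewrite mem_set//|rewrite memNset//=].
  by rewrite subrr mulr0.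
- by rewrite subr0 mulr1.
- by apply/negP; rewrite -leNgt.
Qed.

(** For almost every x both sums stay within the bound, where truncation is the identity and the
    difference is exactly y - y0. *)
Lemma trunc_shift (alpha : probability mR R) (y y0 : mR) :
  \int[alpha]_x \1_beyond (x + y) = 0 -> \int[alpha]_x \1_beyond (x + y0) = 0 ->
  \int[alpha]_x trunc (x + y) - \int[alpha]_x trunc (x + y0) = y - y0.
Proof.
move=> Hy Hy0.
have bb z : bounded_mfun (fun x : mR => \1_beyond (x + z) : R).
  exact: (bmf_comp (measurable_addr z) bmf_beyond).
have bt z : bounded_mfun (fun x : mR => trunc (x + z)).
  exact: (bmf_comp (measurable_addr z) bmf_trunc).
pose D (x : mR) := trunc (x + y) - trunc (x + y0) - (y - y0).
have bc : bounded_mfun (fun _ : mR => (y - y0 : R)) by exact: bmf_cst.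
have btt : bounded_mfun (fun x : mR => trunc (x + y) - trunc (x + y0))
  by exact: bmfB.
have bD : bounded_mfun D by exact: bmfB.
pose C := `|M| + `|M| + `|(y - y0 : R)|.
have C0 : 0 <= C by rewrite !addr_ge0.
(* [G] is 0 where both sums are within the bound and at least the crude bound [C] elsewhere. It
   dominates |D| and has integral 0. *)
pose G (x : mR) : R := C * (\1_beyond (x + y) + \1_beyond (x + y0)).
have bG : bounded_mfun G by apply: bmfM; [exact: bmf_cst|exact: bmfD].
have EG : \int[alpha]_x G x = 0.
  rewrite RintegralZl_bmf//; last exact: bmfD.
  by rewrite RintegralD_bmf// Hy Hy0 addr0 mulr0.
have DG x : `|D x| <= G x.
  have DC : `|D x| <= C.
    rewrite /D (le_trans (ler_normB _ _))// lerD2r (le_trans (ler_normB _ _))//.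
    by rewrite lerD// trunc_le.
  have i0 z : 0 <= \1_beyond z :> R by rewrite indicE.
  have [xy|xy] := ltP M `|(x + y : R)|.
    rewrite (le_trans DC)// /G ler_peMr// [X in _ <= X + _]indicE mem_set//.
    by rewrite lerDl.
  have [xy0|xy0] := ltP M `|(x + y0 : R)|.
    rewrite (le_trans DC)// /G ler_peMr// [X in _ <= _ + X]indicE mem_set//.
    by rewrite lerDr.
  rewrite /D /trunc !ltNge xy xy0 /= (_ : _ - _ - _ = 0); last by ring.
  by rewrite normr0 mulr_ge0// addr_ge0.
have : \int[alpha]_x D x = 0.
  apply/eqP; rewrite eq_le -{1}EG; apply/andP; split.
    by apply: le_Rintegral_bmf => // x; rewrite (le_trans (ler_norm _)).
  have -> : 0 = \int[alpha]_x (-1 * G x) by rewrite RintegralZl_bmf// EG mulr0.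
  apply: le_Rintegral_bmf => //; first by apply: bmfM => //; exact: bmf_cst.
  by move=> x; have := DG x; rewrite mulN1r ler_norml => /andP[].
by rewrite /D RintegralB_bmf// RintegralB_bmf// Rintegral_prob_cst// => /eqP;
  rewrite subr_eq0 => /eqP.
Qed.

(* A summand that is bounded together with y0 is shifted in mean by exactly
   y - y0, so the difference of the means of the two sums does not depend on
   the common summand. *)
Lemma convolution_mean_sub (a1 a2 b b0 : probability mR R)
    (k1 k2 l1 l2 : {measure set mR -> \bar R}) :
  k1 setT = 1%E -> k2 setT = 1%E -> l1 setT = 1%E -> l2 setT = 1%E ->
  is_convolution a1 b k1 -> is_convolution a2 b k2 -> is_convolution a1 b0 l1 ->
    is_convolution a2 b0 l2 ->
  k1 beyond = 0%E -> k2 beyond = 0%E -> l1 beyond = 0%E -> l2 beyond = 0%E ->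
  \int[k1]_t trunc t - \int[k2]_t trunc t =
  \int[l1]_t trunc t - \int[l2]_t trunc t.
Proof.
move=> k1T k2T l1T l2T k1E k2E l1E l2E k10 k20 l10 l20.
(* By Fubini the mass of [beyond] is an average over y of nonnegative terms, so for almost every y
   the term vanishes. *)
have null (a b' : probability mR R) (k : {measure set mR -> \bar R}) :
    k setT = 1%E -> is_convolution a b' k -> k beyond = 0%E ->
    {ae b', forall y, \int[a]_x \1_beyond (x + y) = 0 :> R}.
  move=> kT kE k0; apply: bmf_ge0_ae_eq0 => //.
  - by apply: bmf_conv; exact: bmf_beyond.
  - by move=> y; apply: Rintegral_ge0 => x _; rewrite indicE.
  - rewrite -(Rintegral_convolution kT kE bmf_beyond) Rintegral_indic//.
      by rewrite k0.
    exact: measurable_beyond.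
(* A single y0 that is admissible for both [a1] and [a2] serves as reference point for [b] and [b0]
   alike. *)
have [y0 [h1 h2]] : exists y0, \int[a1]_x \1_beyond (x + y0) = 0 :> R /\
    \int[a2]_x \1_beyond (x + y0) = 0 :> R.
  apply: (@ae_exists _ _ _ b0) => //.
  move: (null _ _ _ l1T l1E l10) (null _ _ _ l2T l2E l20).
  by apply: filterS2; first exact: (ae_filter_ringOfSetsType b0).
have mean (b' : probability mR R) (k k' : {measure set mR -> \bar R}) :
    k setT = 1%E -> k' setT = 1%E -> is_convolution a1 b' k ->
      is_convolution a2 b' k' ->
    k beyond = 0%E -> k' beyond = 0%E ->
    \int[k]_t trunc t - \int[k']_t trunc t =
    \int[a1]_x trunc (x + y0) - \int[a2]_x trunc (x + y0).
  move=> kT k'T kE k'E k0 k'0.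
  rewrite (Rintegral_convolution kT kE bmf_trunc)
    (Rintegral_convolution k'T k'E bmf_trunc).
  have bc (a : probability mR R) :
    bounded_mfun (fun y => \int[a]_x trunc (x + y)).
    by apply: bmf_conv; exact: bmf_trunc.
  rewrite -RintegralB_bmf//; [|exact: bc..].
  (* For almost every y, shifting from y to y0 changes both inner means by the same y - y0, so their
     difference is the constant [c]. *)
  set c := RHS; transitivity (\int[b']_y c); last exact: Rintegral_prob_cst.
  apply: bmf_ae_eq; [by apply: bmfB; exact: bc|exact: bmf_cst|].
  move: (null _ _ _ kT kE k0) (null _ _ _ k'T k'E k'0).
  apply: filterS2; first exact: (ae_filter_ringOfSetsType b').
  move=> y y1 y2.
  rewrite /c; have := trunc_shift y1 h1; have := trunc_shift y2 h2.
  move=> /eqP; rewrite subr_eq => /eqP -> /eqP; rewrite subr_eq => /eqP ->.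
  by ring.
by rewrite (mean b k1 k2)// (mean b0 l1 l2).
Qed.

Lemma integral_trunc (k : {measure set mR -> \bar R}) : k setT = 1%E ->
  k beyond = 0%E -> (\int[k]_t (t : R)%:E = (\int[k]_t trunc t)%:E)%E.
Proof.
move=> kT k0; rewrite -integral_bmf//; last exact: bmf_trunc.
apply: ae_eq_integral => //.
- by apply/measurable_EFinP; exact: bmf_trunc.1.
- exists beyond; split => //; first exact: measurable_beyond.
  move=> t /=; apply: contra_notP => tM _; congr EFin.
  by rewrite /trunc; case: ltP => // /tM.
Qed.

End truncation.

(** * Second moments and tails *)

Lemma measurable_norm_gt d (T : measurableType d) (R : realType) (X : T -> R)
    (a : R) : measurable_fun setT X -> measurable [set w | a < `|X w|].
Proof.
move=> mX.
rewrite (_ : [set w | _] = setT `&` (fun w => `|X w|) @^-1` `]a, +oo[%classic).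
  have mX' : measurable_fun setT (fun w => `|X w|) by exact: measurableT_comp.
  by apply: mX' => //; exact: measurable_itv.
by apply/seteqP; split => w; rewrite setTI /= in_itv/= andbT.
Qed.

Section moments.
Context d (T : measurableType d) (R : realType) (P : {measure set T -> \bar R}).
Hypothesis P1 : P setT = 1%E.

(** Induction on n: the cross term of the partial sum with the new term is a sum of vanishing
    products, and the new square adds at most K^2. *)
Lemma orthogonal_second_moment (Y : nat -> T -> R) (K : R) n :
  (forall i, bounded_mfun (Y i)) -> (forall i w, `|Y i w| <= K) ->
  (forall i j, (i < j < n)%N -> \int[P]_w (Y i w * Y j w) = 0) ->
  \int[P]_w (\sum_(i < n) Y i w) ^+ 2 <= n%:R * K ^+ 2.
Proof.
move=> bY YK; elim: n => [|n IHn] orth.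
  by under eq_Rintegral do rewrite big_ord0 expr0n; rewrite Rintegral_prob_cst//
    mul0r.
pose S w := \sum_(i < n) Y i w; have bS : bounded_mfun S by exact: bmf_sum.
under eq_Rintegral => w _.
  rewrite big_ord_recr /= -/(S w) sqrrD -mulr_natl (_ : _ + _ + _ =
    S w * S w + (2 * (S w * Y n w) + Y n w * Y n w)); last by ring.
  over.
have bSY : bounded_mfun (fun w => S w * Y n w) by exact: bmfM.
have b2SY : bounded_mfun (fun w => 2 * (S w * Y n w)).
  by apply: bmfM => //; exact: bmf_cst.
rewrite RintegralD_bmf//; [|exact: bmfM|by apply: bmfD => //; exact: bmfM].
rewrite RintegralD_bmf//; [|exact: bmfM].
rewrite RintegralZl_bmf// (_ : \int[P]_w (S w * Y n w) = 0) ?mulr0 ?add0r.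
  rewrite -natr1 mulrDl mul1r lerD//.
    by apply: IHn => i j /andP[ij jn]; apply: orth; rewrite ij ltnW.
  rewrite -[leRHS](Rintegral_prob_cst P1); apply: le_Rintegral_bmf => //;
    first exact: bmfM.
    exact: bmf_cst.
  by move=> w; rewrite -expr2 -real_normK ?num_real// lerXn2r//
    nnegrE (le_trans _ (YK n w)).
under eq_Rintegral do rewrite mulr_suml.
rewrite Rintegral_sum_bmf//; last by move=> i; exact: bmfM.
by rewrite big1// => i _; rewrite orth// ltn_ord /=.
Qed.

(** Chebyshev's inequality: integrate a^2 1{|S| > a} <= S^2. *)
Lemma second_moment_tail (S : T -> R) (V a : R) : bounded_mfun S -> 0 < a ->
  \int[P]_w S w ^+ 2 <= V -> fine (P [set w | a < `|S w|]) <= V / a ^+ 2.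
Proof.
move=> bS a0 SV; rewrite ler_pdivlMr ?exprn_gt0// mulrC (le_trans _ SV)//.
have mA : measurable [set w | a < `|S w|] by exact: measurable_norm_gt bS.1.
rewrite -Rintegral_indic// -RintegralZl_bmf//; last exact: bmf_indic.
apply: le_Rintegral_bmf => //.
- exact: bmfM (bmf_cst _ _) (bmf_indic _ mA).
- exact: (bmfM bS bS).
move=> w; rewrite indicE; case: (boolP (w \in _)) => [|_].
  rewrite inE /= mulr1 => aS.
  rewrite -[leRHS]real_normK ?num_real//.
  by apply: lerXn2r; rewrite ?nnegrE//; exact: ltW.
by rewrite mulr0 sqr_ge0.
Qed.

End moments.

(** * Orthogonality in the measurement model *)

Section experiment.
Context (R : realType) (dU : measure_display) (U : measurableType dU)
  (F : finType) (C : Type) (e : experiment R U F).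
Local Notation P := (Pr e).
Local Notation mR := (measurableTypeR R).

(** The generators of [history], named separately so that [g_sigma_algebraType] turns each past into
    a measurable type. *)
Definition history_gens (a b k : nat) : set (set (sample e)) :=
  (\bigcup_(j in `I_a) preimage_set_system setT (@prog _ _ _ _ e j) setT) `|`
  (\bigcup_(j in `I_b) preimage_set_system setT (state e j) measurable) `|`
  (\bigcup_(j in `I_k) preimage_set_system setT (meas e j) measurable).

Local Notation historyT a b k := (g_sigma_algebraType (history_gens a b k)).

Lemma historyE a b k : @history _ _ _ _ e a b k = <<s history_gens a b k >>.
Proof. by []. Qed.

Lemma prog_preimage_measurable j (A : set F) :
  measurable (@prog _ _ _ _ e j @^-1` A).
Proof.
rewrite (_ :
  _ @^-1` A = \big[setU/set0]_(f : F | f \in A)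
    (@prog _ _ _ _ e j @^-1` [set f])).
  by apply: bigsetU_measurable => f _; exact: prog_measurable.
rewrite -bigcup_seq_cond; apply/seteqP; split => [w /= Aw|w [f /= /andP[_ fA]]].
  by exists (prog j w) => //=; rewrite mem_index_enum /=; exact/mem_set.
by move: fA; rewrite inE /= => fA ->.
Qed.

Lemma history_measurable a b k :
  <<s history_gens a b k >> `<=` @measurable _ (sample e).
Proof.
apply: smallest_sub; first exact: sigma_algebra_measurable.
move=> A [[|]|] [j _ [B mB <-]]; rewrite setTI.
- exact: prog_preimage_measurable.
- by rewrite -[X in measurable X]setTI; exact: (measurable_funPT (state e j)).
- by rewrite -[X in measurable X]setTI; exact: (measurable_funPT (meas e j)).
Qed.

Lemma history_mono a b k a' b' k' : (a <= a')%N -> (b <= b')%N -> (k <= k')%N ->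
  <<s history_gens a b k >> `<=` <<s history_gens a' b' k' >>.
Proof.
move=> aa bb kk; apply: sub_sigma_algebra2 => A.
move=> [[|]|] [j jn HA]; [left; left|left; right|right]; exists j => //=;
  exact: leq_trans jn _.
Qed.

Lemma prog_bmf a b k j (h : F -> R) : (j < a)%N ->
  @bounded_mfun _ (historyT a b k) R (fun w => h (prog j w)).
Proof.
move=> ja; split.
  move=> _ B mB; rewrite setTI; apply: sub_sigma_algebra; left; left.
  by exists j => //; exists (h @^-1` B) => //; rewrite setTI.
by exists (\sum_f `|h f|) => w; rewrite (bigD1 (prog j w))//= lerDl sumr_ge0.
Qed.

Lemma state_bmf a b k j (h : U -> R) : (j < b)%N -> bounded_mfun h ->
  @bounded_mfun _ (historyT a b k) R (fun w => h (state e j w)).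
Proof.
move=> jb [mh [K hK]]; split; last by exists K => w; exact: hK.
move=> _ B mB; rewrite setTI; apply: sub_sigma_algebra; left; right.
exists j => //; exists (h @^-1` B); last by rewrite setTI.
by rewrite -[X in measurable X]setTI; exact: mh.
Qed.

Lemma meas_bmf a b k j (h : mR -> R) : (j < k)%N -> bounded_mfun h ->
  @bounded_mfun _ (historyT a b k) R (fun w => h (meas e j w)).
Proof.
move=> jk [mh [K hK]]; split; last by exists K => w; exact: hK.
move=> _ B mB; rewrite setTI; apply: sub_sigma_algebra; right.
exists j => //; exists (h @^-1` B); last by rewrite setTI.
by rewrite -[X in measurable X]setTI; exact: mh.
Qed.

Lemma history_bmf_mono a b k a' b' k' (X : sample e -> R) :
  (a <= a')%N -> (b <= b')%N -> (k <= k')%N ->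
  @bounded_mfun _ (historyT a b k) R X ->
    @bounded_mfun _ (historyT a' b' k') R X.
Proof.
move=> aa bb kk [mX bX]; split => // _ B mB.
by apply: (history_mono aa bb kk); exact: mX.
Qed.

Lemma history_bmf a b k (X : sample e -> R) :
  @bounded_mfun _ (historyT a b k) R X -> bounded_mfun X.
Proof. exact/bmf_sub_sigma/history_measurable. Qed.

Variables (env : environment R U F C) (D : design R F C) (c : C) (n : nat).
Hypothesis model : measurement_model e env D c n.
Let p : R := #|F|%:R^-1.
Hypothesis uniform : forall i (fs : i.-tuple F) ts f, policy D c fs ts f = p.

(** [W] may depend on the current state and on all earlier runs, but not on F_i; given these the
    design chooses f with probability p. *)
Lemma prog_orthogonal i f (W : sample e -> R) : (i < n)%N ->
  @bounded_mfun _ (historyT i i.+1 i) R W ->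
  \int[P]_w (W w * ((prog i w == f)%:R - p)) = 0.
Proof.
move=> ilt; apply: integral_sub_sigma_eq0 => //;
  first exact: history_measurable.
  by apply: (@history_bmf i.+1 0 0);
    apply: (prog_bmf _ _ (fun g => (g == f)%:R - p)).
move=> H GH; have mH := history_measurable GH.
have [/(_ f) /(_ H GH) HP _ _] := model ilt.
have bH : bounded_mfun (\1_H : sample e -> R) by exact: bmf_indic.
have mf := prog_measurable e i f.
under eq_Rintegral => w _.
  rewrite (_ : _ * _ = \1_(H `&` prog i @^-1` [set f]) w - p * \1_H w);
    last first.
    rewrite mulrBr [p * _]mulrC; congr (_ - _).
    rewrite indicI /=; congr (_ * _); rewrite indicE; congr (nat_of_bool _)%:R.
    by apply/eqP/idP; rewrite inE.
  over.
rewrite RintegralB_bmf//;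
  [|by apply/bmf_indic/measurableI|by apply: bmfM => //; exact: bmf_cst].
rewrite RintegralZl_bmf// !Rintegral_indic//; last exact: measurableI.
apply/eqP; rewrite subr_eq0; apply/eqP; apply: eq_trans (congr1 fine HP) _.
under eq_integral do rewrite uniform.
by rewrite integral_cst// fineM// fin_num_measure.
Qed.

(** On the event F_i = h the conditional law of T_i is the kernel of the fixed program h at U_i. The
    indicator of that event is absorbed into the conditioning event, and [integral_kernel_law]
    applies. *)
Lemma meas_orthogonal i h (phi : mR -> R) (W : sample e -> R) : (i < n)%N ->
  bounded_mfun phi -> @bounded_mfun _ (historyT i.+1 i.+1 i) R W ->
  \int[P]_w (W w * ((prog i w == h)%:R *
    (phi (meas e i w) - \int[meas_law env c h (state e i w)]_t phi t))) = 0.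
Proof.
move=> ilt bphi.
have bprog :
  @bounded_mfun _ (historyT i.+1 i.+1 i) R (fun w => (prog i w == h)%:R).
  exact: (prog_bmf _ _ (fun g => (g == h)%:R)).
have bZ : bounded_mfun (fun w => phi (meas e i w) -
    \int[meas_law env c h (state e i w)]_t phi t).
  apply: (@history_bmf i.+1 i.+1 i.+1); apply: bmfB.
    exact: meas_bmf.
  by apply: (state_bmf _ _ _ (bmf_kernel (meas_law env c h) bphi)).
apply: integral_sub_sigma_eq0 => //; first exact: history_measurable.
  by apply: bmfM => //; exact: history_bmf bprog.
move=> H GH; have mH := history_measurable GH.
pose A := H `&` prog i @^-1` [set h].
have GA : @history _ _ _ _ e i.+1 i.+1 i A.
  rewrite historyE; apply: (@measurableI _ (historyT i.+1 i.+1 i)) => //.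
  apply: sub_sigma_algebra; left; left; exists i => //=.
  by exists [set h] => //; rewrite setTI.
have [_ mod2 _] := model ilt.
under eq_Rintegral => w _.
  rewrite mulrA (_ : \1_H w * (prog i w == h)%:R = \1_A w); last first.
    rewrite indicI /=; congr (_ * _); rewrite indicE; congr (nat_of_bool _)%:R.
    by apply/eqP/idP; rewrite inE.
  over.
apply: (integral_kernel_law _ (history_measurable GA)
  (measurable_funPT (state e i)) (measurable_funPT (meas e i)) _ bphi) => //.
move=> B mB; apply: eq_trans (mod2 _ mB _ GA) _.
by apply: eq_integral => w; rewrite inE => -[_ /= ->].
Qed.

(** Only the program actually run is seen in T_i, but every h has probability p > 0 given the state.
    So 0 = P(F_i = h, T_i in B) is p times the mean of a nonnegative function of U_i, which must
    vanish almost surely. *)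
Lemma state_null i h (B : set mR) : (i < n)%N -> measurable B ->
  {ae P, forall w, ~ B (meas e i w)} ->
  {ae P, forall w, meas_law env c h (state e i w) B = 0%E}.
Proof.
move=> ilt mB TB.
have p0 : p != 0 by rewrite invr_eq0 pnatr_eq0 -lt0n; apply/card_gt0P; exists h.
have b1 : bounded_mfun (\1_B : mR -> R) by exact: bmf_indic.
pose m u := \int[meas_law env c h u]_t (\1_B t : R).
have bm : bounded_mfun m by exact: bmf_kernel.
pose m' w := m (state e i w).
have bm' : @bounded_mfun _ (historyT i i.+1 i) R m' by exact: state_bmf.
have bm1 : bounded_mfun m' by exact: history_bmf bm'.
have b1T : bounded_mfun (fun w : sample e => \1_B (meas e i w) : R).
  exact: history_bmf (meas_bmf 0 0 (ltnSn i) b1).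
have bprog : bounded_mfun (fun w : sample e => (prog i w == h)%:R : R).
  exact: history_bmf (prog_bmf 0 0 (fun g => (g == h)%:R) (ltnSn i)).
have E0 : \int[P]_w ((prog i w == h)%:R * \1_B (meas e i w)) = 0 :> R.
  rewrite -[RHS](Rintegral_prob_cst (probability_setT P)).
  apply: bmf_ae_eq; [exact: bmfM|exact: bmf_cst|].
  by apply: filterS TB => w Bw; rewrite indicE memNset// mulr0.
have E1 := meas_orthogonal h ilt b1 (bmf_cst _ 1).
have E2 := prog_orthogonal h ilt bm'.
have E3 : \int[P]_w m' w = 0.
  apply: (mulfI p0); rewrite mulr0 -RintegralZl_bmf//.
  (* p m' is the integrand of [E0] minus those of [E1] and [E2]. *)
  rewrite (eq_Rintegral P
    (g := fun w => (prog i w == h)%:R * \1_B (meas e i w) -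
    (1 * ((prog i w == h)%:R * (\1_B (meas e i w) - m' w))) -
    m' w * ((prog i w == h)%:R - p))); last by move=> w _; ring.
  have bA : bounded_mfun (fun w => (prog i w == h)%:R * \1_B (meas e i w) : R)
    by exact: bmfM.
  have bB : bounded_mfun
    (fun w => 1 * ((prog i w == h)%:R * (\1_B (meas e i w) - m' w))).
    by apply: bmfM; [exact: bmf_cst|apply: bmfM => //; exact: bmfB].
  have bC : bounded_mfun (fun w => m' w * ((prog i w == h)%:R - p)).
    by apply: bmfM => //; apply: bmfB => //; exact: bmf_cst.
  rewrite RintegralB_bmf//; last exact: bmfB.
  by rewrite RintegralB_bmf// E0 E1 E2 !subr0.
have m0 w : 0 <= m' w by apply: Rintegral_ge0 => t _; rewrite indicE.
have := bmf_ge0_ae_eq0 (probability_setT P) bm1 m0 E3.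
apply: filterS => w; rewrite /m' /m Rintegral_indic// => m'0.
rewrite -[LHS]fineK ?m'0// ge0_fin_numE//.
rewrite (@le_lt_trans _ _ (meas_law env c h (state e i w) setT))//.
  by apply: le_measure; rewrite ?inE.
by rewrite prob_kernel ltry.
Qed.

Variables (phi : mR -> R) (mu : F -> R) (g nu : U -> R).
Hypotheses (bphi : bounded_mfun phi) (bg : bounded_mfun g)
  (bnu : bounded_mfun nu).
Hypothesis centred : forall h u,
  g u * (\int[meas_law env c h u]_t phi t - mu h) = nu u.

(** The X_i of the idea, masked by [g], which will be the indicator of the states where T is bounded
    under every program. By [centred] its mean given program and state depends on the state
    alone. *)
Definition residual i (w : sample e) : R :=
  g (state e i w) * (phi (meas e i w) - mu (prog i w)).

Lemma residual_bmf i : @bounded_mfun _ (historyT i.+1 i.+1 i.+1) R (residual i).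
Proof.
apply: bmfM; first exact: state_bmf.
by apply: bmfB; [exact: meas_bmf|exact: prog_bmf].
Qed.

Lemma prog_dev_bmf i f :
  @bounded_mfun _ (historyT i.+1 i.+1 i.+1) R (fun w => (prog i w == f)%:R - p).
Proof. exact: (prog_bmf _ _ (fun h => (h == f)%:R - p)). Qed.

(** Conditioning on the past and F_i replaces the residual by nu(U_i), whatever the program. What is
    left is a function of the past and U_i times [F_i = f] - p, settled by [prog_orthogonal]. *)
Lemma residual_orthogonal i f (W : sample e -> R) : (i < n)%N ->
  @bounded_mfun _ (historyT i i.+1 i) R W ->
  \int[P]_w (W w * (((prog i w == f)%:R - p) * residual i w)) = 0.
Proof.
move=> ilt bW.
have bWg : @bounded_mfun _ (historyT i i.+1 i) R
  (fun w => W w * g (state e i w)).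
  by apply: bmfM => //; exact: state_bmf.
have bWn : @bounded_mfun _ (historyT i i.+1 i) R
  (fun w => W w * nu (state e i w)).
  by apply: bmfM => //; exact: state_bmf.
pose m h u := \int[meas_law env c h u]_t phi t.
pose t h w := W w * g (state e i w) *
  ((prog i w == h)%:R * (phi (meas e i w) - m h (state e i w))).
have bt h : bounded_mfun (t h).
  apply: (@history_bmf i.+1 i.+1 i.+1); apply: bmfM.
    by apply: history_bmf_mono bWg.
  apply: bmfM; first exact: (prog_bmf _ _ (fun k => (k == h)%:R)).
  apply: bmfB; first exact: meas_bmf.
  by apply: (state_bmf _ _ _ (bmf_kernel (meas_law env c h) bphi)).
have Et h : \int[P]_w t h w = 0.
  by apply: meas_orthogonal => //; exact: history_bmf_mono bWg.
have bpt h : bounded_mfun (fun w => ((h == f)%:R - p) * t h w).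
  by apply: bmfM => //; exact: bmf_cst.
(* Only the term h = F_i of the sum is nonzero. Summing over h trades the random program in the
   kernel for fixed ones, as [meas_orthogonal] requires. *)
rewrite (eq_Rintegral P (g := fun w => \sum_h (((h == f)%:R - p) * t h w) +
    W w * nu (state e i w) * ((prog i w == f)%:R - p))); last first.
  move=> w _; rewrite (bigD1 (prog i w))//= big1 => [|h hi]; last first.
    by rewrite /t [prog i w == h]eq_sym (negbTE hi) mul0r !mulr0.
  by rewrite /t eqxx /residual -(centred (prog i w)) -/(m _ _) /=; ring.
rewrite RintegralD_bmf//; last 2 first.
- exact: bmf_sum.
- apply: bmfM; first exact: history_bmf bWn.
  exact: history_bmf (prog_dev_bmf i f).
rewrite prog_orthogonal// addr0 Rintegral_sum_bmf//.
by rewrite big1// => h _; rewrite RintegralZl_bmf// Et mulr0.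
Qed.

Lemma p_ge0 : 0 <= p. Proof. by rewrite invr_ge0. Qed.

Lemma prog_dev_le1 i f (w : sample e) : `|(prog i w == f)%:R - p| <= 1.
Proof.
have p1 : p <= 1.
  rewrite invf_le1 ?ler1n ?ltr0n; first by apply/card_gt0P; exists f.
  by apply/card_gt0P; exists f.
have := p_ge0; case: (_ == _) => p0; rewrite ler_norml /=; lra.
Qed.

Lemma count_dev_second_moment f :
  \int[P]_w (\sum_(i < n) ((prog i w == f)%:R - p)) ^+ 2 <= n%:R.
Proof.
rewrite -[leRHS]mulr1 -[X in _ * X](expr1n _ 2).
apply: (orthogonal_second_moment (probability_setT P)
  (Y := fun i w => (prog i w == f)%:R - p)).
- by move=> i; exact: history_bmf (prog_dev_bmf i f).
- by move=> i w; exact: prog_dev_le1.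
move=> i j /andP[ij jn]; apply: prog_orthogonal => //.
by apply: history_bmf_mono (prog_dev_bmf i f) => //; exact: ltnW.
Qed.

Lemma residual_dev_second_moment f K :
  (forall i w, `|residual i w| <= K) ->
  \int[P]_w (\sum_(i < n) ((prog i w == f)%:R - p) * residual i w) ^+ 2 <=
  n%:R * K ^+ 2.
Proof.
move=> rK.
have bY i : @bounded_mfun _ (historyT i.+1 i.+1 i.+1) R
    (fun w => ((prog i w == f)%:R - p) * residual i w).
  by apply: bmfM; [exact: prog_dev_bmf|exact: residual_bmf].
apply: (orthogonal_second_moment (probability_setT P)
  (Y := fun i w => ((prog i w == f)%:R - p) * residual i w)).
- by move=> i; exact: history_bmf (bY i).
- move=> i w; rewrite normrM -[leRHS]mul1r ler_pM//; exact: prog_dev_le1.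
(* For i < j the whole i-th term belongs to the history before run j, so it can play the role of
   [W]. *)
move=> i j /andP[ij jn]; apply: residual_orthogonal => //.
by apply: history_bmf_mono (bY i) => //; exact: ltnW.
Qed.

End experiment.

(** * Mean measurements under the additive effect *)

Section kernel_at.
Context d d' (U : measurableType d) (V : measurableType d') (R : realType)
  (k : R.-pker U ~> V) (u : U).

(** The measure [k u] under a name of its own, to carry the structure of a probability. *)
Definition kernel_at : set V -> \bar R := k u.

HB.instance Definition _ := isMeasure.Build _ _ _ kernel_at
  (measure0 (k u)) (measure_ge0 (k u))
    (@measure_semi_sigma_additive _ _ _ (k u)).

HB.instance Definition _ :=
  Measure_isProbability.Build _ _ _ kernel_at (prob_kernel u).

End kernel_at.

Section mean_laws.
Context (R : realType) (dU : measure_display) (U : measurableType dU)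
  (F : finType) (C : Type) (env : environment R U F C)
  (L : additive_laws R U F C) (M : R) (c : C).
Local Notation mR := (measurableTypeR R).

(** This is m_h(u) of the idea; on [bounded_state] the truncation does not change the mean. *)
Definition trunc_mean h u : R := \int[meas_law env c h u]_t trunc M t.

Definition bounded_state : set U :=
  [set u | forall h, meas_law env c h u (beyond M) = 0%E].

Lemma bmf_trunc_mean h : bounded_mfun (trunc_mean h).
Proof. by apply: bmf_kernel; exact: bmf_trunc. Qed.

Lemma measurable_bounded_state : measurable bounded_state.
Proof.
rewrite (_ : bounded_state = \bigcap_(h in [set: F])
    [set u | meas_law env c h u (beyond M) = 0%E]); last first.
  by apply/seteqP; split => u /= Hu h; [move=> _|]; exact: Hu.
apply: fin_bigcap_measurable => [|h _]; first exact: finite_finset.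
rewrite -[X in measurable X]setTI.
by apply: (measurable_kernel (meas_law env c h) _ (measurable_beyond M)
  measurableT [set 0%E]).
Qed.

Lemma ref_bounded_state :
  {ae ref_state env c, forall u, forall h,
     meas_law env c h u [set t : mR | `|(t : R)| <= M] = 1%E} ->
  {ae ref_state env c, forall u, bounded_state u}.
Proof.
apply: filterS => u Hu h.
have bE : beyond M = ~` [set t : mR | `|(t : R)| <= M].
  by apply/seteqP; split => t; rewrite /beyond /= ltNge => /negP.
have mb := measurable_beyond M.
have mI : measurable [set t : mR | `|(t : R)| <= M].
  by rewrite -[X in measurable X]setCK -bE; exact: measurableC.
have kT : meas_law env c h u setT = 1%E by exact: prob_kernel.
have kU : (meas_law env c h u (setT : set mR) =
    meas_law env c h u [set t : mR | (`|(t : R)| <= M)%R] +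
    meas_law env c h u (beyond M))%E.
  rewrite -measureU//; last by rewrite bE setICr.
  by rewrite bE setUCr.
move: kU; rewrite kT Hu; case: (meas_law env c h u (beyond M)) => // r [] /eqP.
by rewrite addrC -subr_eq subrr => /eqP <-.
Qed.

Hypothesis additive : forall h u (B : set mR), measurable B ->
  meas_law env c h u B = (true_law L c h \x noise_law L c u)%E
    [set x : mR * mR | B (x.1 + x.2)].

(** The splitting m_h(u) = mu_h + nu(u) on bounded states, expressed without choosing mu and nu: the
    laws at u and v differ only in the noise summand, which [convolution_mean_sub] cancels. *)
Lemma trunc_mean_sub h k u v : bounded_state u -> bounded_state v ->
  trunc_mean h u - trunc_mean k u = trunc_mean h v - trunc_mean k v.
Proof.
move=> Gu Gv.
by apply: (@convolution_mean_sub _ M (true_law L c h) (true_law L c k) 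
  (kernel_at (noise_law L c) u) (kernel_at (noise_law L c) v)) => //;
  move=> B mB; exact: additive.
Qed.

(** The identity is unbounded, so its positive and negative parts are integrated separately. *)
Lemma measurable_kernel_mean (k : R.-pker U ~> mR) :
  measurable_fun setT (fun u => \int[k u]_t (t : R)%:E)%E.
Proof.
under eq_fun do rewrite integralE.
apply: emeasurable_funB.
- apply: measurable_fun_integral_kernel => //.
  + by move=> B mB; exact: measurable_kernel.
  + by apply: measurable_funepos; apply/measurable_EFinP.
- apply: measurable_fun_integral_kernel => //.
  + by move=> B mB; exact: measurable_kernel.
  + by apply: measurable_funeneg; apply/measurable_EFinP.
Qed.

Lemma true_lossE h : {ae ref_state env c, forall u, bounded_state u} ->
  true_loss env h c = \int[ref_state env c]_u trunc_mean h u.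
Proof.
move=> Gref; congr fine; apply: ae_eq_integral => //.
- exact: measurable_kernel_mean.
- by apply/measurable_EFinP; exact: (bmf_trunc_mean h).1.
by apply: filterS Gref => u Gu _; apply: integral_trunc.
Qed.

(** At almost every reference state the difference of means equals the one at u, so averaging over
    the reference distribution returns that value. *)
Lemma true_deltaE h k u : {ae ref_state env c, forall u, bounded_state u} ->
  bounded_state u ->
  true_delta env c h k = trunc_mean h u - trunc_mean k u.
Proof.
move=> Gref Gu; rewrite /true_delta !true_lossE//.
have bm := bmf_trunc_mean.
rewrite -RintegralB_bmf//.
set a := RHS; transitivity (\int[ref_state env c]_v a);
  last exact: Rintegral_prob_cst.
apply: bmf_ae_eq; [exact: bmfB|exact: bmf_cst|].
by apply: filterS Gref => v Gv; exact: trunc_mean_sub.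
Qed.

End mean_laws.

(** * Deterministic error estimate and union bound *)

(** The error equals (D - (N - p n) S / n) / N, where |S / n| <= K and 1 / N <= 2 / (p n). *)
Lemma ratio_error (R : realType) (N n S D p K t : R) : 0 < n -> 0 < p ->
  0 <= K -> 0 <= t -> p * n / 2 <= N -> `|S| <= n * K -> `|D| <= t ->
  `|N - p * n| <= t ->
  `|N^-1 * (D + p * S) - S / n| <= (1 + K) * t * 2 / (p * n).
Proof.
move=> n0 p0 K0 t0 N2 SK Dt Nt.
have pn0 : 0 < p * n by rewrite mulr_gt0.
have N0 : 0 < N by rewrite (lt_le_trans _ N2)// divr_gt0.
have -> : N^-1 * (D + p * S) - S / n = N^-1 * (D - (N - p * n) * (S / n)).
  by field; rewrite !gt_eqF.
rewrite normrM gtr0_norm ?invr_gt0//.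
rewrite (_ : _ / (p * n) = (p * n / 2)^-1 * ((1 + K) * t)); last first.
  by field; rewrite !gt_eqF.
apply: ler_pM => //; first by rewrite invr_ge0 ltW.
  by rewrite lef_pV2// posrE// divr_gt0.
rewrite (le_trans (ler_normB _ _))// [leRHS]mulrDl mul1r lerD//
  normrM mulrC ler_pM//.
by rewrite normrM normfV (gtr0_norm n0) ler_pdivrMr// mulrC.
Qed.

(** A union bound off the null set [N], obtained by integrating the corresponding inequality between
    indicators. *)
Lemma prob_le_sum d (T : measurableType d) (R : realType) (P : probability T R)
    (I : eqType) (r : seq I) (A N : set T) (B : I -> set T) :
  measurable A -> measurable N -> (forall i, measurable (B i)) -> P N = 0%E ->
  (forall w, A w -> ~ N w -> exists2 i, i \in r & B i w) ->
  fine (P A) <= \sum_(i <- r) fine (P (B i)).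
Proof.
move=> mA mN mB N0 AB.
have bI (X : set T) : measurable X ->
  bounded_mfun (\1_X : T -> R) by exact: bmf_indic.
have -> : \sum_(i <- r) fine (P (B i)) =
    \int[P]_w (\1_N w + \sum_(i <- r) \1_(B i) w).
  rewrite RintegralD_bmf//; [|exact: bI|by apply: bmf_sum => i; exact: bI].
  rewrite Rintegral_indic// Rintegral_sum_bmf//; last by move=> i; exact: bI.
  rewrite (_ : fine _ = 0) ?add0r; last exact: (congr1 fine N0).
  by apply: eq_bigr => i _; rewrite Rintegral_indic.
rewrite -Rintegral_indic//; apply: le_Rintegral_bmf => //; first exact: bI.
  by apply: bmfD; [exact: bI|apply: bmf_sum => i; exact: bI].
have i0 (X : set T) w : 0 <= \1_X w :> R by rewrite indicE.
move=> w; rewrite [leLHS]indicE; case: (boolP (w \in A)); last first.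
  by move=> _; rewrite addr_ge0// sumr_ge0.
rewrite inE => Aw; have [Nw|Nw] := pselect (N w).
  by rewrite [X in _ <= X + _]indicE mem_set// lerDl sumr_ge0.
have [i ir Biw] := AB w Aw Nw.
by rewrite (big_rem i)//= [X in _ <= _ + (X + _)]indicE mem_set// addrCA lerDl
  addr_ge0// sumr_ge0.
Qed.

(** * Measurability of run counts and of the estimator *)

Section measurability.
Context (R : realType) (dU : measure_display) (U : measurableType dU)
  (F : finType) (e : experiment R U F) (n : nat).

Lemma run_countE h (w : sample e) :
  (run_count n h w)%:R = \sum_(i < n) (prog i w == h)%:R :> R.
Proof. by rewrite /run_count natr_sum. Qed.

Lemma bmf_prog_eq i h :
  bounded_mfun (fun w : sample e => (prog i w == h)%:R : R).
Proof.
exact: history_bmf (prog_bmf e 0 0 (fun k => (k == h)%:R) (ltnSn i)).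
Qed.

Lemma bmf_run_count h :
  bounded_mfun (fun w : sample e => (run_count n h w)%:R : R).
Proof.
under eq_fun do rewrite run_countE.
by apply: bmf_sum => i; exact: bmf_prog_eq.
Qed.

Lemma measurable_run_count h (A : set nat) :
  measurable [set w : sample e | A (run_count n h w)].
Proof.
rewrite (_ : [set w | _] = \bigcup_(k in A) [set w | run_count n h w = k]).
  apply: bigcup_measurable => k _.
  rewrite (_ : [set w | _] =
      setT `&` (fun w : sample e => (run_count n h w)%:R : R) @^-1` [set k%:R]).
    by apply: (bmf_run_count h).1 => //; exact: measurable_set1.
  apply/seteqP; split => w; rewrite setTI /=; first by move=> ->.
  by move/eqP; rewrite eqr_nat => /eqP.
by apply/seteqP; split => w /= => [Aw|[k Ak ->]//]; exists (run_count n h w).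
Qed.

Lemma measurable_all_programs_run : measurable (all_programs_run (e := e) n).
Proof.
rewrite (_ : all_programs_run _ = \bigcap_(h in [set: F])
    [set w | (fun k => 0 < k)%N (run_count n h w)]); last first.
  by apply/seteqP; split => w /= Hw h; [move=> _|]; exact: Hw.
apply: fin_bigcap_measurable => [|h _]; first exact: finite_finset.
exact: (measurable_run_count h [set k | (0 < k)%N]).
Qed.

Lemma measurable_loss_estimator h :
  measurable_fun setT (fun w : sample e => loss_estimator n h w).
Proof.
apply: measurable_funM.
  move=> _ B mB; rewrite setTI.
  exact: (measurable_run_count h [set k | B (k%:R^-1)]).
apply: measurable_sum => i; apply: measurable_funM.
  exact: (bmf_prog_eq i h).1.
exact: measurable_funPT (meas e i).
Qed.

End measurability.

(** * Tail bounds for a single experiment *)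

Section one_experiment.
Context (R : realType) (dU : measure_display) (U : measurableType dU)
  (F : finType) (C : Type) (env : environment R U F C)
  (L : additive_laws R U F C) (M : R) (D : design R F C) (c : C) (n : nat)
  (e : experiment R U F).
Hypothesis design_e : simple_randomized_design env L M D c n e.
Variable u0 : U.
Hypothesis u0_bounded : bounded_state env M c u0.
Local Notation P := (Pr e).
Let p : R := #|F|%:R^-1.
Let K : R := `|M| + `|M|.
(** mu_h is the mean at the reference state [u0]; another bounded state would shift all mu_h by one
    common constant. *)
Let mu h := trunc_mean env M c h u0.
Let res := residual (e := e) (trunc M) mu (\1_(bounded_state env M c)).
Let count_dev h (w : sample e) := \sum_(i < n) ((prog i w == h)%:R - p).
Let res_dev h (w : sample e) := \sum_(i < n) ((prog i w == h)%:R - p) * res i w.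
Let S (w : sample e) := \sum_(i < n) res i w.

Let model : measurement_model e env D c n.
Proof. by case: design_e => -[]. Qed.

Let uniform : forall i (fs : i.-tuple F) ts h, policy D c fs ts h = p.
Proof. by case: design_e. Qed.

Let K0 : 0 <= K. Proof. by rewrite addr_ge0. Qed.

Let res_le i w : `|res i w| <= K.
Proof.
rewrite /res /residual normrM -[leRHS]mul1r ler_pM//.
  by rewrite indicE; case: (_ \in _); rewrite ?normr1 ?normr0.
rewrite (le_trans (ler_normB _ _))// lerD ?trunc_le//.
by apply: normr_Rintegral_bmf_le;
  [exact: prob_kernel|exact: bmf_trunc|exact: trunc_le].
Qed.

Let S_le w : `|S w| <= n%:R * K.
Proof.
rewrite (le_trans (ler_norm_sum _ _ _))// mulr_natl.
rewrite -[X in _ *+ X]card_ord -sumr_const; apply: ler_sum => i _;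
  exact: res_le.
Qed.

Let count_devE h w : count_dev h w = (run_count n h w)%:R - p * n%:R.
Proof.
by rewrite /count_dev big_split /= run_countE sumr_const card_ord mulr_natr
  mulNrn.
Qed.

Let bmf_g : bounded_mfun (\1_(bounded_state env M c) : U -> R).
Proof. exact/bmf_indic/measurable_bounded_state. Qed.

Let bmf_res i : bounded_mfun (res i).
Proof. exact: history_bmf (residual_bmf e mu (bmf_trunc M) bmf_g i). Qed.

Let bmf_count_dev h : bounded_mfun (count_dev h).
Proof. by apply: bmf_sum => i; exact: history_bmf (prog_dev_bmf e i h). Qed.

Let bmf_res_dev h : bounded_mfun (res_dev h).
Proof.
apply: bmf_sum => i; apply: bmfM => //.
exact: history_bmf (prog_dev_bmf e i h).
Qed.

Let good (w : sample e) := forall i, (i < n)%N ->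
  ~ beyond M (meas e i w) /\ bounded_state env M c (state e i w).

(** The reference distribution says nothing about the states visited by the experiment. Their
    boundedness under all programs is derived from that of the measurements by [state_null]. *)
Let ae_good : {ae P, forall w, good w}.
Proof.
have [[_ _ [_ Tb] _ _] _] := design_e.
apply: ae_foralln => i; have [ilt|] := ltnP i n; last by move=> _; exact: aeW.
have Ti : {ae P, forall w, ~ beyond M (meas e i w)}.
  by apply: filterS (Tb i ilt) => w; rewrite /beyond /= ltNge => ->.
have Ui : {ae P, forall w, bounded_state env M c (state e i w)}.
  apply: filter_forall => h; apply: (state_null model uniform) => //.
  exact: measurable_beyond.
by move: Ti Ui; apply: filterS2.
Qed.

(** On a good outcome truncation and mask disappear, so N_h times the left side is the sum of
    [F_i = h] X_i, and [F_i = h] = ([F_i = h] - p) + p. *)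
Let loss_good h w : good w -> (0 < run_count n h w)%N ->
  loss_estimator n h w - mu h =
  (run_count n h w)%:R^-1 * (res_dev h w + p * S w).
Proof.
move=> Gw Nh.
have N0 : (run_count n h w)%:R != 0 :> R by rewrite pnatr_eq0 -lt0n.
rewrite /loss_estimator -[mu h](mulKf N0) -mulrBr; congr (_ * _).
rewrite run_countE mulr_suml -sumrB /res_dev /S mulr_sumr -big_split /=.
apply: eq_bigr => i _; rewrite -mulrDl subrK /res /residual.
have [Ti Ui] := Gw i (ltn_ord i).
rewrite indicE mem_set// mul1r -mulrBr /trunc /=.
move/negP: Ti => /= /negbTE ->; have [->//|] := eqVneq (prog i w) h.
by rewrite !mul0r.
Qed.

Lemma loss_deviation h w t : good w -> 0 < n%:R :> R -> t < p * n%:R / 2 ->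
  `|count_dev h w| <= t -> `|res_dev h w| <= t ->
  `|loss_estimator n h w - mu h - S w / n%:R| <= (1 + K) * t * 2 / (p * n%:R).
Proof.
move=> Gw n0 tpn ct rt.
have p0 : 0 < p by rewrite invr_gt0 ltr0n; apply/card_gt0P; exists h.
have t0 : 0 <= t by exact: le_trans ct.
(* A count deviation of at most t < p n / 2 leaves at least p n / 2 runs of h, in particular a
   positive number. *)
have cN : p * n%:R / 2 <= (run_count n h w)%:R.
  have := ct; rewrite count_devE ler_norml => /andP[c1 _].
  have : p * n%:R / 2 + p * n%:R / 2 = p * n%:R by rewrite -splitr.
  by move: tpn c1; lra.
rewrite loss_good//; last first.
  by rewrite -(ltr_nat R) (lt_le_trans _ cN)// (le_lt_trans t0).
by apply: ratio_error => //; rewrite -count_devE.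
Qed.

(** The hypothesis [centred], with nu written through one fixed program [h]: the right side is free
    of [k]. *)
Let mean_sub h : forall k u, \1_(bounded_state env M c) u *
    (\int[meas_law env c k u]_t trunc M t - mu k) =
  \1_(bounded_state env M c) u * (trunc_mean env M c h u - mu h) :> R.
Proof.
move=> k u; rewrite indicE; case: (boolP (u \in _)); last by rewrite !mul0r.
rewrite inE => Gu; congr (_ * _); rewrite -/(trunc_mean env M c k u) /mu.
have [[_ [addL _] _ _ _] _] := design_e.
have := trunc_mean_sub addL k h Gu u0_bounded; lra.
Qed.

(** With t = s sqrt n, outside four Chebyshev events (count and residual deviations of f and g) and
    a null set, both loss errors are close to S / n, which cancels in the difference. *)
Lemma estimated_delta_tail f g s : 0 < s -> (0 < n)%N ->
  s * Num.sqrt n%:R < p * n%:R / 2 ->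
  fine (P ([set w | 4 * (1 + K) * s / p <
    `|(estimated_delta n f g w - (mu f - mu g)) / (n%:R `^ (- 2^-1))|]
    `&` all_programs_run (e := e) n)) <= 4 * (K ^+ 2 + 1) / s ^+ 2.
Proof.
move=> s0 n0 sn.
have n0R : 0 < n%:R :> R by rewrite ltr0n.
have r0 : 0 < Num.sqrt n%:R :> R by rewrite sqrtr_gt0.
have rr : Num.sqrt n%:R * Num.sqrt n%:R = n%:R :> R by rewrite -expr2
  sqr_sqrtr// ltW.
have p0 : 0 < p by rewrite invr_gt0 ltr0n; apply/card_gt0P; exists f.
pose t := s * Num.sqrt n%:R.
have t0 : 0 < t by rewrite mulr_gt0.
have tt : t ^+ 2 = s ^+ 2 * n%:R by rewrite exprMn [X in _ * X]expr2 rr.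
have aE : n%:R `^ (- 2^-1) = (Num.sqrt n%:R)^-1 :> R.
  by rewrite powRN powR12_sqrt// ltW.
have [N [mN PN GN]] := ae_good.
pose dev (bh : bool * F) := if bh.1 then count_dev bh.2 else res_dev bh.2.
pose B bh := [set w | t < `|dev bh w|].
have bdev bh : bounded_mfun (dev bh) by rewrite /dev; case: ifP.
have mB bh : measurable (B bh) by apply: measurable_norm_gt; exact: (bdev bh).1.
set A := (X in fine (P X)).
have mA : measurable A.
  apply: measurableI; last exact: measurable_all_programs_run.
  apply: measurable_norm_gt; apply: measurable_funM; last exact: measurable_cst.
  apply: measurable_funB; last exact: measurable_cst.
  by apply: measurable_funB; exact: measurable_loss_estimator.
(* The second moments are at most n for counts and n K^2 for residuals; n (K^2 + 1) covers both. *)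
have PB bh : fine (P (B bh)) <= (K ^+ 2 + 1) / s ^+ 2.
  have -> : (K ^+ 2 + 1) / s ^+ 2 = n%:R * (K ^+ 2 + 1) / t ^+ 2.
    by rewrite tt; field; rewrite !gt_eqF.
  apply: second_moment_tail => //.
  case: bh => -[] h; rewrite /dev /=.
    rewrite (le_trans (count_dev_second_moment model uniform h))//.
    by rewrite -[leLHS]mulr1 ler_wpM2l ?ler0n// lerDr sqr_ge0.
  have bnu : bounded_mfun (fun u => \1_(bounded_state env M c) u *
      (trunc_mean env M c h u - mu h) : R).
    apply: bmfM => //; apply: bmfB; last exact: bmf_cst.
    exact: bmf_trunc_mean.
  rewrite (le_trans (residual_dev_second_moment model uniform (bmf_trunc M)
    bmf_g bnu (mean_sub h) h res_le))//.
  by rewrite ler_wpM2l ?ler0n// lerDl.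
apply: le_trans (prob_le_sum (N := N) (B := B)
  (r := [:: (true, f); (true, g); (false, f); (false, g)]) mA mN mB _ _) _.
- exact: PN.
- move=> w Aw Nw; apply: contrapT => noB.
  have Gw : good w by apply: contrapT => /GN.
  have le bh : bh \in [:: (true, f); (true, g); (false, f); (false, g)] ->
      `|dev bh w| <= t.
    by move=> bhr; rewrite leNgt; apply/negP => tb; apply: noB; exists bh.
  pose d h := loss_estimator n h w - mu h - S w / n%:R.
  have [lf lg] : `|d f| <= (1 + K) * t * 2 / (p * n%:R) /\
      `|d g| <= (1 + K) * t * 2 / (p * n%:R).
    split; apply: loss_deviation => //.
    + by apply: (le (true, f)); rewrite !inE eqxx.
    + by apply: (le (false, f)); rewrite !inE eqxx ?orbT.
    + by apply: (le (true, g)); rewrite !inE eqxx ?orbT.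
    + by apply: (le (false, g)); rewrite !inE eqxx ?orbT.
  have [] := Aw => /= + _; apply/negP;
    rewrite -leNgt aE invrK normrM (gtr0_norm r0).
  have -> : 4 * (1 + K) * s / p =
      2 * ((1 + K) * t * 2 / (p * n%:R)) * Num.sqrt n%:R.
    rewrite /t; move: (Num.sqrt _) r0 rr => r r0 <-.
    by field; rewrite !gt_eqF.
  apply: ler_wpM2r; first exact: ltW.
  rewrite /estimated_delta (_ : _ - _ - _ = d f - d g); last first.
    by rewrite /d; ring.
  by rewrite (le_trans (ler_normB _ _))// mulr_natl mulr2n lerD.
rewrite !big_cons big_nil addr0.
have := PB (true, f); have := PB (true, g); have := PB (false, f);
  have := PB (false, g).
by rewrite -mulrA; lra.
Qed.

(** A program that is never run has count deviation p n, beyond p n / 2; sum Chebyshev's bound over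
    all programs. *)
Lemma all_programs_run_ge (f : F) : (0 < n)%N ->
  1 - #|F|%:R * (4 / (p ^+ 2 * n%:R)) <= fine (P (all_programs_run (e := e) n)).
Proof.
move=> n0.
have n0R : 0 < n%:R :> R by rewrite ltr0n.
have p0 : 0 < p by rewrite invr_gt0 ltr0n; apply/card_gt0P; exists f.
have pn0 : 0 < p * n%:R / 2 by rewrite divr_gt0// mulr_gt0.
have mA := measurable_all_programs_run e n.
pose B h := [set w | p * n%:R / 2 < `|count_dev h w|].
have mB h : measurable (B h).
  by apply: measurable_norm_gt; exact: (bmf_count_dev h).1.
have PB h : fine (P (B h)) <= 4 / (p ^+ 2 * n%:R).
  have -> : 4 / (p ^+ 2 * n%:R) = n%:R / (p * n%:R / 2) ^+ 2.
    by field; rewrite !gt_eqF.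
  apply: second_moment_tail => //.
  exact: count_dev_second_moment model uniform h.
have PC : fine (P (~` all_programs_run (e := e) n)) <=
    #|F|%:R * (4 / (p ^+ 2 * n%:R)).
  have -> : #|F|%:R * (4 / (p ^+ 2 * n%:R)) = \sum_(h : F) 4 / (p ^+ 2 * n%:R).
    by rewrite sumr_const mulr_natl.
  apply: (@le_trans _ _ (\sum_(h : F) fine (P (B h)))); last exact: ler_sum.
  apply: (prob_le_sum (N := set0)) => //; first exact: measurableC.
  move=> w /existsNP[h /negP]; rewrite -eqn0Ngt => /eqP Nh _.
  exists h; first by rewrite mem_index_enum.
  rewrite /B /= count_devE Nh sub0r normrN gtr0_norm ?mulr_gt0//.
  by rewrite ltr_pdivrMr// ltr_pMr ?mulr_gt0// ltr1n.
have := probability_setC P (measurableC mA); rewrite setCK => /(congr1 fine).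
rewrite fineB ?fin_num_measure//; last exact: measurableC.
by rewrite /= => ->; rewrite lerB.
Qed.

End one_experiment.

(** * Choice of constants and passage to the conditional law *)

Theorem theorem38 (R : realType) (dU : measure_display) (U : measurableType dU)
    (F : finType) (hF : (2 <= #|F|)%N) (C : Type)
    (env : environment R U F C) (L : additive_laws R U F C) (M : R)
    (D : design R F C) (c : C) (f g : F) (hfg : f <> g)
    (e : nat -> experiment R U F)
    (he : forall n : nat, simple_randomized_design env L M D c n (e n)) :
  bigO_p_given (fun n => Pr (e n))
    (fun n => all_programs_run (e := e n) n)
    (fun n w => estimated_delta n f g w - true_delta env c f g)
    (fun n => n%:R `^ (- 2^-1)).
Proof.
(* The assumptions on the laws themselves do not mention the experiment, so the one with no runs
   already supplies them. *)
have [[_ [additive _] [ref_bounded _] _ _] _] := he 0%N.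
have Gref := ref_bounded_state ref_bounded.
have [u0 Gu0] := ae_exists (probability_setT (ref_state env c)) Gref.
rewrite (true_deltaE additive f g Gref Gu0) => eps eps0.
pose p : R := #|F|%:R^-1.
have p0 : 0 < p by rewrite invr_gt0 ltr0n (leq_trans _ hF).
pose K : R := `|M| + `|M|.
have K1 : 0 < K ^+ 2 + 1 by rewrite ltr_wpDl ?sqr_ge0.
(* This makes the tail 4 (K^2 + 1) / s^2 equal to eps / 2; the factor 2 is spent on conditioning by
   an event of probability at least 1/2. *)
pose s : R := Num.sqrt (8 * (K ^+ 2 + 1) / eps).
have q0 : 0 < 8 * (K ^+ 2 + 1) / eps by rewrite divr_gt0// mulr_gt0.
have s0 : 0 < s by rewrite sqrtr_gt0.
have s2 : s ^+ 2 = 8 * (K ^+ 2 + 1) / eps by rewrite sqr_sqrtr// ltW.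
(* For n > X the first summand gives s sqrt n < p n / 2, and the second bounds the probability that
   some program is never run by 1/2. *)
pose X : R := (2 * s / p) ^+ 2 + 8 * #|F|%:R / p ^+ 2.
have Y0 : 0 <= 8 * #|F|%:R / p ^+ 2 by rewrite divr_ge0 ?sqr_ge0// mulr_ge0.
have X0 : 0 <= X by rewrite addr_ge0 ?sqr_ge0.
exists (4 * (1 + K) * s / p), (Num.bound X) => n Xn.
have Xltn : X < n%:R by rewrite (lt_le_trans (archi_boundP X0))// ler_nat.
have n0R : 0 < n%:R :> R by exact: le_lt_trans Xltn.
have n0 : (0 < n)%N by rewrite -(ltr_nat R).
have r0 : 0 < Num.sqrt n%:R :> R by rewrite sqrtr_gt0.
have sn : s * Num.sqrt n%:R < p * n%:R / 2.
  have sr : 2 * s / p < Num.sqrt n%:R.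
    rewrite -(ltr_pXn2r (n := 2))// ?nnegrE ?sqrtr_ge0//; last first.
      by rewrite divr_ge0 ?mulr_ge0// ltW.
    by rewrite sqr_sqrtr ?(ltW n0R)// (le_lt_trans _ Xltn)// lerDl.
  have -> : p * n%:R / 2 = p * Num.sqrt n%:R / 2 * Num.sqrt n%:R.
    rewrite -[in LHS](sqr_sqrtr (ltW n0R)); ring.
  by rewrite ltr_pM2r//; move: sr; rewrite ltr_pdivrMr//; lra.
have half : 2^-1 <= fine (Pr (e n) (all_programs_run (e := e n) n)).
  apply: le_trans (all_programs_run_ge (he n) f n0); rewrite -/p.
  have : 8 * #|F|%:R / p ^+ 2 <= n%:R.
    by rewrite (le_trans _ (ltW Xltn))// lerDr sqr_ge0.
  rewrite ler_pdivrMr ?exprn_gt0// => H.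
  have pn : 0 < p ^+ 2 * n%:R by rewrite mulr_gt0 ?exprn_gt0.
  have : #|F|%:R * (4 / (p ^+ 2 * n%:R)) <= 2^-1.
    rewrite mulrA ler_pdivrMr//; move: H; lra.
  lra.
have tail := estimated_delta_tail (he n) Gu0 f g s0 n0 sn.
rewrite /cond_prob ler_pdivrMr; last by rewrite (lt_le_trans _ half).
rewrite (le_trans tail)// -/K s2 (le_trans _ (ler_wpM2l (ltW eps0) half))//.
rewrite (_ : 4 * _ / _ = eps / 2)//.
by field; rewrite !gt_eqF.
Qed.
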